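(* Let $\mathcal M=(M_k)_{k\in\mathbb N_0}$ be a sequence of matrices in $GL(n,\mathbb R)$ with operator norms $t_k=\|M_k\|_{op}$, and let $\mathcal Z=(Z_k)_{k\in\mathbb N_0}$ be a sequence of $\tau_k$-separated subsets of $\mathbb R^n$ ($\tau_k>0$). Let $\varphi:\mathbb R^+\to\mathbb R^+$ be a function such that for all $c>0$ and all $t\in\mathbb R^+$, $$|\{k:\ \log(t_k/\tau_k)\in(t-c,t]\}|\le\varphi(c).$$ Let $X\subset\mathbb R^n$ be the support of a locally finite Borel measure $\mu$ that is absolutely $(\tau,c_\tau)$-decaying with respect to affine hyperplanes and satisfies a power law with exponent $\delta$ and constants $c_1,c_2$. Suppose $\varphi(c)\le e^{\bar\tau c}$ with $0<\bar\tau<\tau$. Then there exists $c_0>0$ such that for all $c>c_0$ $$\dim\big(E_{\mathcal M,\mathcal Z}(e^{-(2c+\log12)})\cap X\big)\ \ge\ \delta-\frac{\log\big(2\tfrac{c_2^2}{c_1^2}\big)+2\delta\log2+|\log(1-c_\tau2^\tau\varphi(c)e^{-\tau c})|}{c}.$$ In particular, if $\mu$ is Lebesgue measure (so that $X=\mathbb R^n$ and $\tau=1$), there exist constants $k_l,\bar k_l>0$ and $c_0>0$ such that for all $c>c_0$ $$\dim\big(E_{\mathcal M,\mathcal Z}(e^{-c})\big)\ \ge\ n-\frac{|\log(1-\bar k_l\,\varphi(c/2)e^{-c/2})|}{c/2-k_l}.$$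
   Context: $\dim$ is Hausdorff dimension and $d$ is Euclidean distance. $Z_k$ is $\tau_k$-separated if $d(y_1,y_2)\ge\tau_k$ for all distinct $y_1,y_2\in Z_k$. For $c>0$, $E_{\mathcal M,\mathcal Z}(c)=\{x\in\mathbb R^n: d(M_kx,Z_k)\ge c\,\tau_k\text{ for all }k\in\mathbb N_0\}$. Let $t_*\in\mathbb R\cup\{-\infty\}$; the numbers $\log(t_k/\tau_k)$ are all at least some $s_*>t_*$. For $x\in\mathbb R^n$, $B(x,r)$ is the closed Euclidean ball, and for $Y\subset\mathbb R^n$, $\mathcal N(Y,t)=\bigcup_{y\in Y}B(y,e^{-t})$. Absolutely $(\tau,c_\tau)$-decaying: $\mu(B(x,e^{-t})\cap\mathcal N(S,t+s))\le c_\tau e^{-\tau s}\mu(B(x,e^{-t}))$ for all $x\in X$, $t>t_*$, $s\ge0$ and all affine hyperplanes $S\subset\mathbb R^n$. Power law with exponent $\delta$ and constants $c_2\ge c_1>0$: $c_1e^{-\delta t}\le\mu(B(x,e^{-t}))\le c_2e^{-\delta t}$ for all $x\in X$, $t>t_*$. *)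

(* Defs.v *)
From HB Require Import structures.
From mathcomp Require Import all_boot all_order all_algebra.
From mathcomp Require Import all_classical all_reals all_analysis.

Set Implicit Arguments.
Unset Strict Implicit.
Unset Printing Implicit Defensive.

Import Order.TTheory GRing.Theory Num.Theory.
Import numFieldNormedType.Exports.

Local Open Scope classical_set_scope.
Local Open Scope ring_scope.

Section Euclidean.
Context {R : realType} {n : nat}.
Implicit Types (x y : 'cV[R]_n) (A S Y Z : set 'cV[R]_n).

(* The library norm on matrices is the sup norm; it induces the same topology
   as the Euclidean norm below. *)
Definition eucl_norm x : R := Num.sqrt (\sum_i x i 0 ^+ 2).

Definition eucl_dist x y : R := eucl_norm (x - y).

Definition eucl_ball x (r : R) : set 'cV[R]_n := [set y | eucl_dist x y <= r].

(* +oo when Z is empty *)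
Definition eucl_dist_set x Z : \bar R :=
  ereal_inf [set (eucl_dist x z)%:E | z in Z].

Definition opnorm (M : 'M[R]_n) : R :=
  sup [set eucl_norm (M *m x) | x in [set x | eucl_norm x <= 1]].

Definition eucl_separated (r : R) Z :=
  forall y1 y2, Z y1 -> Z y2 -> y1 <> y2 -> r <= eucl_dist y1 y2.

Definition affine_hyperplane S :=
  exists (a : 'cV[R]_n) (b : R),
    a != 0 /\ S = [set x | \sum_i a i 0 * x i 0 = b].

Definition eucl_nbhd Y (t : R) : set 'cV[R]_n :=
  \bigcup_(y in Y) eucl_ball y (expR (- t)).

End Euclidean.

Section Hausdorff.
Context {R : realType} {n : nat}.
Implicit Types (A U : set 'cV[R]_n) (s e : R).
Local Open Scope ereal_scope.

(* -oo when U is empty *)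
Definition eucl_diam U : \bar R :=
  ereal_sup [set (eucl_dist x y)%:E | x in U & y in U].

(* diam(U)^s, where the empty set has weight 0 even for s = 0 *)
Definition hausdorff_weight s U : \bar R :=
  if U == set0 then 0 else eucl_diam U `^ s.

Definition hausdorff_premeasure s e A : \bar R :=
  ereal_inf [set \sum_(0 <= k <oo) hausdorff_weight s (U k) |
    U in [set U : nat -> set 'cV[R]_n |
      A `<=` \bigcup_k U k /\ forall k, eucl_diam (U k) <= e%:E]].

Definition hausdorff_measure s A : \bar R :=
  ereal_sup [set hausdorff_premeasure s e A | e in [set e : R | (0 < e)%R]].

(* The dimension of the empty set is 0. *)
Definition hausdorff_dim A : \bar R :=
  ereal_inf [set s%:E | s in
    [set s : R | (0 <= s)%R /\ hausdorff_measure s A = 0]].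

End Hausdorff.

(* R^n with its Borel sigma-algebra *)
Notation borelRn R n := (g_sigma_algebraType (@open 'cV[R]_n)).

Section Measures.
Context {R : realType} {n : nat}.
Variable mu : {measure set (borelRn R n) -> \bar R}.
Local Open Scope ereal_scope.

Definition locally_finite :=
  forall x : 'cV[R]_n, exists U : set 'cV[R]_n,
    [/\ open U, U x & mu U < +oo].

Definition msupport : set 'cV[R]_n :=
  [set x | forall U : set 'cV[R]_n, open U -> U x -> 0 < mu U].

(* The lower bound ts on the scales t may be -oo. *)
Definition absolutely_decaying (X : set 'cV[R]_n) (ts : \bar R)
    (tau ctau : R) :=
  forall (x : 'cV[R]_n) (t s : R) (S : set 'cV[R]_n),
    X x -> ts < t%:E -> (0 <= s)%R -> affine_hyperplane S ->
    mu (eucl_ball x (expR (- t)) `&` eucl_nbhd S (t + s)) <=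
      (ctau * expR (- (tau * s)))%:E * mu (eucl_ball x (expR (- t))).

Definition power_law (X : set 'cV[R]_n) (ts : \bar R) (delta c1 c2 : R) :=
  forall (x : 'cV[R]_n) (t : R), X x -> ts < t%:E ->
    (c1 * expR (- (delta * t)))%:E <= mu (eucl_ball x (expR (- t))) /\
    mu (eucl_ball x (expR (- t))) <= (c2 * expR (- (delta * t)))%:E.

(* Lebesgue measure, as the Borel measure giving every box its volume *)
Definition is_lebesgue :=
  forall a b : 'cV[R]_n, (forall i, a i 0 <= b i 0)%R ->
    mu [set x : 'cV[R]_n | forall i, (a i 0 <= x i 0 <= b i 0)%R] =
    (\prod_i (b i 0 - a i 0))%:E.

End Measures.

Definition Eset {R : realType} {n : nat} (M : nat -> 'M[R]_n)
    (Z : nat -> set 'cV[R]_n) (tauk : nat -> R) (c : R) : set 'cV[R]_n :=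
  [set x | forall k, ((c * tauk k)%:E <= eucl_dist_set (M k *m x) (Z k))%E].

(* Main.v *)
(* At stage j we have a node: a small set of size e^(-T_j), up to a constant.
   For every k with log (t_k / tau_k) in the window (T_j - c, T_j], separation
   leaves at most one point of Z_k near the image of the node under M_k, and
   the part of the node mapped near that point lies in a thin slab around an
   affine hyperplane.  There are at most phi(c) such slabs.  Keeping N children
   that avoid them all and have positive mutual gaps gives a Cantor set inside
   E of dimension at least log N / log (1/b), where b is the contraction ratio.
   For a decaying measure the nodes are balls centered in X and N comes from a
   greedy separated family.  For Lebesgue measure a multiplicative loss in N is
   too much: the nodes are cubes, divided into K^n cells, and a slab meets
   O(K^(n-1)) of them, whence N >= K^n (1 - O(phi(c) / K)); the cells are shrunk
   by the factor K / (K+1) to create the gaps, which only costs O(1/K), and this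
   is absorbed because phi >= 1. *)

Require Import Defs.
From HB Require Import structures.
From mathcomp Require Import all_boot all_order all_algebra.
From mathcomp Require Import all_classical all_reals all_analysis.

Set Implicit Arguments.
Unset Strict Implicit.
Unset Printing Implicit Defensive.

Import Order.TTheory GRing.Theory Num.Theory.
Import numFieldNormedType.Exports.

Local Open Scope classical_set_scope.
Local Open Scope ring_scope.
From mathcomp Require Import ring lra zify.

(** * Euclidean geometry *)

Section EuclideanGeometry.
Context {R : realType} {n : nat}.
Implicit Types (x y z a b : 'cV[R]_n) (r : R).

Definition dotv a b : R := \sum_i a i 0 * b i 0.

Lemma dotvC a b : dotv a b = dotv b a.
Proof. by apply: eq_bigr => i _; rewrite mulrC. Qed.

Lemma dotvDl a b x : dotv (a + b) x = dotv a x + dotv b x.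
Proof. by rewrite /dotv -big_split; apply: eq_bigr => i _; rewrite !mxE mulrDl. Qed.

Lemma dotvZl r a x : dotv (r *: a) x = r * dotv a x.
Proof. by rewrite /dotv mulr_sumr; apply: eq_bigr => i _; rewrite !mxE mulrA. Qed.

Lemma dotvNl a x : dotv (- a) x = - dotv a x.
Proof. by rewrite -scaleN1r dotvZl mulN1r. Qed.

Lemma dotvBl a b x : dotv (a - b) x = dotv a x - dotv b x.
Proof. by rewrite dotvDl dotvNl. Qed.

Lemma dotvDr a b x : dotv x (a + b) = dotv x a + dotv x b.
Proof. by rewrite dotvC dotvDl !(dotvC x). Qed.

Lemma dotvZr r a x : dotv x (r *: a) = r * dotv x a.
Proof. by rewrite dotvC dotvZl dotvC. Qed.

Lemma dotvBr a b x : dotv x (a - b) = dotv x a - dotv x b.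
Proof. by rewrite dotvC dotvBl !(dotvC x). Qed.

Lemma dotv_mulmx (M : 'M[R]_n) a b : dotv a (M *m b) = dotv (M^T *m a) b.
Proof.
rewrite /dotv; under eq_bigr => i _ do rewrite mxE mulr_sumr.
rewrite exchange_big /=; apply: eq_bigr => j _; rewrite mxE mulr_suml.
by apply: eq_bigr => i _; rewrite mxE mulrCA mulrA.
Qed.

Lemma dotvv_ge0 x : 0 <= dotv x x.
Proof. by apply: sumr_ge0 => i _; rewrite -expr2 sqr_ge0. Qed.

Lemma eucl_norm_sqr x : eucl_norm x ^+ 2 = dotv x x.
Proof.
rewrite /eucl_norm sqr_sqrtr; last by apply: sumr_ge0 => i _; rewrite sqr_ge0.
by apply: eq_bigr => i _; rewrite expr2.
Qed.

Lemma eucl_norm_ge0 x : 0 <= eucl_norm x.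
Proof. exact: sqrtr_ge0. Qed.

Lemma coord_le_eucl_norm x i : `|x i 0| <= eucl_norm x.
Proof.
rewrite -(@ler_pXn2r _ 2) ?nnegrE ?eucl_norm_ge0 // eucl_norm_sqr.
rewrite /dotv (bigD1 i) //= real_normK ?num_real // expr2 lerDl.
by apply: sumr_ge0 => j _; rewrite -expr2 sqr_ge0.
Qed.

Lemma eucl_norm_eq0 x : eucl_norm x = 0 -> x = 0.
Proof.
move=> x0; apply/matrixP => i j; rewrite (ord1 j) mxE.
by apply/normr0_eq0/eqP; rewrite -normr_le0 normr_id -x0 coord_le_eucl_norm.
Qed.

Lemma eucl_norm0 : eucl_norm (0 : 'cV[R]_n) = 0.
Proof.
apply/eqP; rewrite -sqrf_eq0 eucl_norm_sqr; apply/eqP/big1 => i _.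
by rewrite mxE mul0r.
Qed.

Lemma eucl_norm_gt0 x : x != 0 -> 0 < eucl_norm x.
Proof.
rewrite lt_def eucl_norm_ge0 andbT.
exact: contra_neq (@eucl_norm_eq0 x).
Qed.

Lemma eucl_normZ r x : eucl_norm (r *: x) = `|r| * eucl_norm x.
Proof.
apply/eqP; rewrite -(@eqrXn2 _ 2) ?mulr_ge0 ?eucl_norm_ge0 // exprMn.
by rewrite !eucl_norm_sqr dotvZl dotvZr real_normK ?num_real // mulrA expr2.
Qed.

Lemma eucl_normN x : eucl_norm (- x) = eucl_norm x.
Proof. by rewrite -scaleN1r eucl_normZ normrN normr1 mul1r. Qed.

Lemma dotv_le a b : dotv a b <= eucl_norm a * eucl_norm b.
Proof.
have [->|a0] := eqVneq a 0.
  rewrite eucl_norm0 mul0r /dotv big1 // => i _.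
  by rewrite mxE mul0r.
have [->|b0] := eqVneq b 0.
  rewrite eucl_norm0 mulr0 /dotv big1 // => i _.
  by rewrite mxE mulr0.
have /eucl_norm_gt0 a1 := a0; have /eucl_norm_gt0 b1 := b0.
have := dotvv_ge0 (eucl_norm b *: a - eucl_norm a *: b).
rewrite dotvBl !dotvBr !dotvZl !dotvZr -!eucl_norm_sqr (dotvC b a).
set p := eucl_norm a in a1 *; set q := eucl_norm b in b1 *; set d := dotv a b.
move=> h; have : 0 <= (p * q) * (p * q - d) by nra.
by rewrite pmulr_rge0 ?mulr_gt0 // subr_ge0.
Qed.

Lemma normr_dotv_le a b : `|dotv a b| <= eucl_norm a * eucl_norm b.
Proof. by rewrite ler_norml dotv_le andbT lerNl -dotvNl -(eucl_normN a) dotv_le. Qed.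

Lemma eucl_normD x y : eucl_norm (x + y) <= eucl_norm x + eucl_norm y.
Proof.
rewrite -(@ler_pXn2r _ 2) ?nnegrE ?addr_ge0 ?eucl_norm_ge0 //.
rewrite eucl_norm_sqr dotvDl !dotvDr (dotvC y x) sqrrD !eucl_norm_sqr.
have := dotv_le x y; lra.
Qed.

Lemma eucl_dist_ge0 x y : 0 <= eucl_dist x y.
Proof. exact: eucl_norm_ge0. Qed.

Lemma eucl_distxx x : eucl_dist x x = 0.
Proof. by rewrite /eucl_dist subrr eucl_norm0. Qed.

Lemma eucl_distC x y : eucl_dist x y = eucl_dist y x.
Proof. by rewrite /eucl_dist -eucl_normN opprB. Qed.

Lemma eucl_dist_triangle y x z : eucl_dist x z <= eucl_dist x y + eucl_dist y z.
Proof. by rewrite (le_trans _ (eucl_normD _ _)) // /eucl_dist addrA subrK. Qed.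

Lemma eucl_norm_le_sup x r : 0 <= r -> (forall i, `|x i 0| <= r) ->
  eucl_norm x <= n%:R * r.
Proof.
move=> r0 xr; rewrite -(@ler_pXn2r _ 2) ?nnegrE ?eucl_norm_ge0 ?mulr_ge0 //.
rewrite eucl_norm_sqr; apply: (@le_trans _ _ (n%:R * r ^+ 2)).
  rewrite -[n in n%:R]card_ord mulr_natl -sumr_const; apply: ler_sum => i _.
  by rewrite -expr2 -real_normK ?num_real // ler_pXn2r ?nnegrE.
rewrite exprMn ler_wpM2r ?sqr_ge0 //.
by case: (n) => [|m]; rewrite ?expr0n // expr2 ler_peMr // ler1n.
Qed.

(** The topology on column vectors is that of the sup norm, so continuity of Euclidean quantities is
    derived from a Lipschitz bound in the coordinatewise distance. *)
Definition lipschitz_sup (f : 'cV[R]_n -> R) (L : R) :=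
  forall x y e, 0 < e -> (forall i, `|x i 0 - y i 0| < e) -> `|f x - f y| <= L * e.

Lemma lipschitz_sup_continuous f L : lipschitz_sup f L -> continuous f.
Proof.
move=> fL x; apply/(@cvgrPdist_lt _ _ _ _ (nbhs_filter x)) => e e0.
have L1 : 0 < `|L| + 1 by rewrite ltr_wpDl.
have d0 : 0 < e / (`|L| + 1) by rewrite divr_gt0.
apply: (@filterS _ _ (nbhs_filter x) (ball x (e / (`|L| + 1)))); last first.
  exact: nbhsx_ballx.
move=> y xyb /=; have xy i : `|x i 0 - y i 0| < e / (`|L| + 1) by exact: (xyb.2 i 0).
apply: le_lt_trans (fL _ _ _ d0 xy) _.
rewrite mulrA ltr_pdivrMr // mulrC ltr_pM2l //.
by rewrite (le_lt_trans (ler_norm L)) // ltrDl.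
Qed.

Lemma eucl_dist_continuous x : continuous (eucl_dist x).
Proof.
apply: (@lipschitz_sup_continuous _ n%:R) => y z e e0 yz.
have yze : eucl_dist y z <= n%:R * e.
  by apply: eucl_norm_le_sup => [|i]; rewrite ?ltW // !mxE.
rewrite ler_norml; apply/andP; split.
  have := eucl_dist_triangle y x z; lra.
by have := eucl_dist_triangle z x y; rewrite (eucl_distC z y); lra.
Qed.

Lemma dotv_continuous a : continuous (dotv a).
Proof.
apply: (@lipschitz_sup_continuous _ (eucl_norm a * n%:R)) => y z e e0 yz.
rewrite -dotvBr (le_trans (normr_dotv_le _ _)) // -mulrA ler_wpM2l ?eucl_norm_ge0 //.
by apply: eucl_norm_le_sup => [|i]; rewrite ?ltW // !mxE.
Qed.

Lemma closed_eucl_ball x r : closed (eucl_ball x r).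
Proof.
have /continuous_closedP dc := @eucl_dist_continuous x.
exact: dc (@closed_le _ r).
Qed.

(** The orthogonal projection of [x] to the hyperplane lies at distance
    [|dotv a x - r| / eucl_norm a]. This turns the neighborhoods of the decay condition into
    slabs. *)
Lemma eucl_nbhd_hyperplane a r s : a != 0 ->
  eucl_nbhd [set x | \sum_i a i 0 * x i 0 = r] s =
  [set x | `|dotv a x - r| <= eucl_norm a * expR (- s)].
Proof.
move=> a0; have /eucl_norm_gt0 a1 := a0; apply/seteqP; split => [x [y /= <-]|x /= xs].
  rewrite /eucl_ball /= => yx; rewrite -[X in _ - X]/(dotv a y) -dotvBr.
  by rewrite (le_trans (normr_dotv_le _ _)) // ler_pM2l // -/(eucl_dist x y) eucl_distC.
pose t := (dotv a x - r) / eucl_norm a ^+ 2.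
exists (x - t *: a) => /=.
  rewrite -[LHS]/(dotv a _) dotvBr dotvZr -eucl_norm_sqr divfK ?sqrf_eq0 ?gt_eqF //.
  by rewrite opprB addrC subrK.
rewrite /eucl_ball /= /eucl_dist addrAC subrr add0r eucl_normN eucl_normZ normrM.
rewrite normfV normrX (ger0_norm (ltW a1)) expr2 invfM mulrA mulfVK ?gt_eqF //.
by rewrite ler_pdivrMr // mulrC.
Qed.

Lemma closed_slab a r s : closed [set x | `|dotv a x - r| <= s].
Proof.
have /continuous_closedP dc := @dotv_continuous a.
apply: (dc [set t | `|t - r| <= s]).
suff /continuous_closedP nc : continuous (fun t : R => `|t - r|) by exact: nc (@closed_le _ s).
move=> t; apply: (@continuous_comp _ _ _ (fun t : R => t - r)); last exact: norm_continuous.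
by apply: cvgB; [exact: cvg_id|exact: cvg_cst].
Qed.

End EuclideanGeometry.

(** * Operator norms, and the slab that a node must avoid for one matrix *)

Section OperatorNorm.
Context {R : realType} {n : nat}.
Implicit Types (x y z a : 'cV[R]_n) (M : 'M[R]_n).

Let image1 M := [set eucl_norm (M *m x) | x in [set x | eucl_norm x <= 1]].

(** Makes the [sup] in [opnorm] a true supremum: Cauchy-Schwarz on the rows of [M] bounds the image
    of the unit ball. *)
Lemma has_sup_opnorm M : has_sup (image1 M).
Proof.
split; first by exists (eucl_norm (M *m 0)), 0; rewrite //= eucl_norm0.
pose B : R := \sum_i eucl_norm (row i M)^T.
have B0 : 0 <= B by apply: sumr_ge0 => i _; exact: eucl_norm_ge0.
exists (n%:R * B) => _ [x /= x1 <-].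
apply: eucl_norm_le_sup => // i.
have -> : (M *m x) i 0 = dotv (row i M)^T x.
  by rewrite mxE; apply: eq_bigr => j _; rewrite !mxE.
rewrite (le_trans (normr_dotv_le _ _)) //.
apply: (@le_trans _ _ (eucl_norm (row i M)^T)); first by rewrite ler_piMr ?eucl_norm_ge0.
by rewrite /B (bigD1 i) //= lerDl sumr_ge0 // => j _; exact: eucl_norm_ge0.
Qed.

Lemma eucl_norm_mulmx_le M x : eucl_norm (M *m x) <= opnorm M * eucl_norm x.
Proof.
have [->|x0] := eqVneq x 0; first by rewrite mulmx0 eucl_norm0 mulr0.
have /eucl_norm_gt0 x1 := x0.
rewrite -ler_pdivrMr //; apply: (sup_upper_bound (has_sup_opnorm M)).
exists ((eucl_norm x)^-1 *: x) => /=.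
  by rewrite eucl_normZ gtr0_norm ?invr_gt0 // mulVf // gt_eqF.
by rewrite -scalemxAr eucl_normZ gtr0_norm ?invr_gt0 // mulrC.
Qed.

Lemma opnorm_gt0 M : (0 < n)%N -> M \in unitmx -> 0 < opnorm M.
Proof.
move=> n0 Mu; pose x : 'cV[R]_n := const_mx 1.
have x0 : x != 0.
  apply/eqP => /matrixP/(_ (Ordinal n0) 0); rewrite !mxE => /eqP.
  by rewrite oner_eq0.
have Mx0 : M *m x != 0.
  by apply/eqP => Mx; case/eqP: x0; rewrite -(mulKmx Mu x) Mx mulmx0.
have Mx_gt0 := eucl_norm_gt0 Mx0; have x_gt0 := eucl_norm_gt0 x0.
by rewrite -(pmulr_lgt0 _ x_gt0) (lt_le_trans Mx_gt0) ?eucl_norm_mulmx_le.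
Qed.

(* [a] is [M^T u], with [u] the direction of the image of an almost
   norm-maximizing vector: this replaces the singular value decomposition. *)
Lemma opnorm_functional M : 0 < opnorm M ->
  exists a u, [/\ a != 0, opnorm M <= 2 * eucl_norm a &
    forall y z, `|dotv a y - dotv u z| <= eucl_dist (M *m y) z].
Proof.
move=> M0; have M2 : 0 < opnorm M / 2 by lra.
have [_ [v /= v1 <-]] := sup_adherent M2 (has_sup_opnorm M); rewrite -/(opnorm M) => Mv.
have Mv0 : 0 < eucl_norm (M *m v) by lra.
pose u := (eucl_norm (M *m v))^-1 *: (M *m v).
have u1 : eucl_norm u = 1.
  by rewrite eucl_normZ gtr0_norm ?invr_gt0 // mulVf // gt_eqF.
(* Since [dotv (M^T *m u) v] is the norm of [M *m v], which exceeds half of [opnorm M],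
   Cauchy-Schwarz with [eucl_norm v <= 1] gives the bound. *)
have aM : opnorm M <= 2 * eucl_norm (M^T *m u).
  have : dotv u (M *m v) = eucl_norm (M *m v).
    by rewrite dotvZl -eucl_norm_sqr expr2 mulKf ?gt_eqF.
  rewrite dotv_mulmx => e; have := dotv_le (M^T *m u) v; rewrite e => le1.
  have := eucl_norm_ge0 (M^T *m u); nra.
exists (M^T *m u), u; split => //.
  by apply/eqP => a0; move: aM; rewrite a0 eucl_norm0; lra.
move=> y z; rewrite -dotv_mulmx -dotvBr (le_trans (normr_dotv_le _ _)) //.
by rewrite u1 mul1r.
Qed.

Lemma eucl_dist_set_ge y (Z : set 'cV[R]_n) r :
  (forall z, Z z -> r <= eucl_dist y z) -> (r%:E <= eucl_dist_set y Z)%E.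
Proof. by move=> h; apply: le_ereal_inf_tmp => _ [z Zz <-]; rewrite lee_fin h. Qed.

(** The image of [Y] has diameter at most [opnorm M * d], so separation leaves at most one dangerous
    point [z] of [Z]. The functional of [opnorm_functional] is 1-Lipschitz in the image distance, so
    points of [Y] mapped close to [z] lie in a slab normal to [a]. *)
Lemma avoid_slab M (Z Y : set 'cV[R]_n) (d e r : R) :
  0 < opnorm M -> eucl_separated r Z ->
  (forall y y', Y y -> Y y' -> eucl_dist y y' <= d) ->
  opnorm M * d + 2 * (e * r) <= r ->
  exists a (b : R), a != 0 /\ forall y, Y y ->
    2 * (e * r) / opnorm M * eucl_norm a <= `|dotv a y - b| ->
    ((e * r)%:E <= eucl_dist_set (M *m y) Z)%E.
Proof.
move=> M0 Zr Yd small; have [a [u [a0 aM aE]]] := opnorm_functional M0.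
have [[y0 [z [Yy0 [Zz y0z]]]]|far] :=
  pselect (exists y0 z, Y y0 /\ (Z z /\ eucl_dist (M *m y0) z < e * r)); last first.
  (* No point of [Z] comes close to the image of [Y], so any slab will do. *)
  exists a, 0; split => // y Yy _; apply: eucl_dist_set_ge => z Zz.
  by rewrite leNgt; apply/negP => yz; apply: far; exists y, z.
exists a, (dotv u z); split => // y Yy ay; apply: eucl_dist_set_ge => z' Zz'.
(* For [z'] other than [z], going from [z'] to [z] through the images of [y] and [y0] costs at least
   [r], of which [opnorm M * d + e * r] is already accounted for. *)
have [->|zz'] := eqVneq z' z; last first.
  have := Zr _ _ Zz' Zz (elimN eqP zz').
  have : eucl_dist (M *m y) (M *m y0) <= opnorm M * d.
    rewrite /eucl_dist -mulmxBr (le_trans (eucl_norm_mulmx_le _ _)) // ler_pM2l //.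
    exact: Yd.
  have := eucl_dist_triangle (M *m y) z' z.
  have := eucl_dist_triangle (M *m y0) (M *m y) z.
  rewrite (eucl_distC z' (M *m y)); lra.
apply: le_trans (aE y z); apply: le_trans ay.
rewrite mulrAC ler_pdivlMr // (mulrC 2) -[leRHS]mulrA ler_wpM2l //.
exact: le_trans (eucl_dist_ge0 _ _) (ltW y0z).
Qed.

End OperatorNorm.

(** * Hausdorff dimension of Cantor trees *)

Section HausdorffLowerBound.
Context {R : realType} {n : nat}.
Implicit Types (A U : set 'cV[R]_n) (s t C : R).

Lemma hausdorff_dim_ge A t :
  (forall s, 0 <= s -> s < t -> hausdorff_measure s A <> 0%E) ->
  (t%:E <= hausdorff_dim A)%E.
Proof.
move=> h; apply: le_ereal_inf_tmp => _ [s /= [s0 As] <-]; rewrite lee_fin leNgt.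
by apply/negP => st; exact: h s0 st As.
Qed.

Lemma eucl_dist_le_diam U x y : U x -> U y -> ((eucl_dist x y)%:E <= eucl_diam U)%E.
Proof. by move=> Ux Uy; apply: ereal_sup_ubound; exists x => //; exists y. Qed.

Lemma hausdorff_weight_ge0 s U : (0 <= hausdorff_weight s U)%E.
Proof. by rewrite /hausdorff_weight; case: ifP => // _; exact: poweR_ge0. Qed.

(* Pulling a cover of [A] back along [h] covers [0, 1) by sets of length at
   most [2 C diam^s], so that Lebesgue measure plays the role of a measure
   on [A]. *)
Lemma hausdorff_measure_gt0 A (h : R -> 'cV[R]_n) C s : 0 < C -> 0 <= s ->
  (forall u, 0 <= u < 1 -> A (h u)) ->
  (forall u v, 0 <= u < 1 -> 0 <= v < 1 -> u != v ->
     `|u - v| <= C * eucl_dist (h u) (h v) `^ s) ->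
  (0 < hausdorff_measure s A)%E.
Proof.
move=> C0 s0 hA hC; apply: (@lt_le_trans _ _ (2 * C)^-1%:E).
  by rewrite lte_fin invr_gt0 mulr_gt0.
(* One scale suffices, the measure being a supremum over scales; at scale 1 all diameters in a cover
   are finite. *)
apply: (@le_trans _ _ (hausdorff_premeasure s 1 A)); last first.
  by apply: ereal_sup_ubound; exists 1 => /=.
apply: le_ereal_inf_tmp => _ [U [AU U1] <-].
pose V k := [set u : R | 0 <= u < 1 /\ U k (h u)].
(* [V k] need not be measurable, so it is enclosed in an interval centered at one of its points,
   with radius [C] times the diameter of [U k] to the power [s]. *)
have VI k : exists I : set R, [/\ measurable I, V k `<=` I &
    (lebesgue_measure I <= (2 * C)%:E * hausdorff_weight s (U k))%E].
  have [[u0 [u01 Uu0]]|V0] := pselect (V k !=set0); last first.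
    exists set0; split => //; first by move=> u Vu; apply: V0; exists u.
    by rewrite measure0 mule_ge0 ?hausdorff_weight_ge0 // lee_fin mulr_ge0 ?ltW.
  have dge := @eucl_dist_le_diam (U k) _ _ Uu0 Uu0.
  have [d dE] : exists d : R, eucl_diam (U k) = d%:E.
    move: (U1 k) dge; case: (eucl_diam (U k)) => [d _ _|//|]; first by exists d.
    by rewrite leeNy_eq.
  have d0 : 0 <= d by move: dge; rewrite dE lee_fin eucl_distxx.
  have Cd0 : 0 <= C * d `^ s by rewrite mulr_ge0 ?powR_ge0 // ltW.
  exists `[u0 - C * d `^ s, u0 + C * d `^ s]%classic; split => //.
    move=> u [u1 Uu] /=; rewrite in_itv /=.
    have : `|u - u0| <= C * d `^ s.
      have [->|uu0] := eqVneq u u0; first by rewrite subrr normr0.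
      apply: le_trans (hC _ _ u1 u01 uu0) _.
      rewrite ler_pM2l // ge0_ler_powR ?nnegrE ?eucl_dist_ge0 //.
      by rewrite -lee_fin -dE; exact: eucl_dist_le_diam.
    by rewrite ler_norml => /andP[]; lra.
  rewrite lebesgue_measure_itv /= lte_fin /hausdorff_weight.
  have /negbTE -> : U k != set0 by apply/eqP => U0; move: Uu0; rewrite U0.
  rewrite dE poweR_EFin -EFinM; case: ifP => _; rewrite -?EFinD lee_fin; first by lra.
  by rewrite -mulrA mulr_ge0.
have /choice [I IP] := VI.
have cover : `[0, 1[%classic `<=` \bigcup_k I k.
  move=> u /=; rewrite in_itv /= => u01; have [k _ Uk] := AU _ (hA _ u01).
  by exists k => //; have [_ + _] := IP k; apply; split.
have mI k : measurable (I k) by have [] := IP k.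
have le1 : (1%:E <= \sum_(0 <= k <oo) lebesgue_measure (I k))%E.
  have <- : lebesgue_measure (`[0, 1[%classic : set R) = 1%:E.
    by rewrite lebesgue_measure_itv /= lte_fin ltr01 -EFinD subr0.
  by have := @measure_sigma_subadditive _ R _ (@lebesgue_measure R) _ I mI (measurable_itv _) cover.
have : (1%:E <= (2 * C)%:E * \sum_(0 <= k <oo) hausdorff_weight s (U k))%E.
  rewrite -nneseriesZl; last by move=> k _; exact: hausdorff_weight_ge0.
  apply: le_trans le1 _; apply: lee_nneseries => k _ //.
  by have [] := IP k.
have C2 : 0 < 2 * C by rewrite mulr_gt0.
by rewrite -lee_pdivrMl // mule1.
Qed.

End HausdorffLowerBound.

(** * Limit points of a tree and its dimension *)

Section CantorTree.
Context {R : realType} {n : nat}.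

(** All later points lie in [F j], whose size is geometrically small, so the sequence is Cauchy; its
    limit stays in each closed [F j]. *)
Lemma nested_limit (F : nat -> set 'cV[R]_n) (x : nat -> 'cV[R]_n) (r b : R) :
  `|b| < 1 -> (forall j, closed (F j)) -> (forall j, F j.+1 `<=` F j) ->
  (forall j, F j (x j)) ->
  (forall j y i, F j y -> `|x j i 0 - y i 0| <= r * b ^+ j) ->
  exists2 y, x @ \oo --> y & forall j, F j y.
Proof.
move=> b1 Fc Fs Fx Fr.
have Fle j l : (j <= l)%N -> F l `<=` F j.
  move=> /subnK <-; elim: (l - j)%N => [//|m IH]; rewrite addSn.
  exact: subset_trans (Fs _) IH.
have rb0 : (fun j => r * b ^+ j) @ \oo --> (0 : R) by exact: cvg_geometric.
have xc : cauchy (x @ \oo).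
  apply: cauchy_exP => e e0.
  have /cvgrPdist_lt /(_ _ e0) [j _ jP] := rb0.
  exists (x j), j => // l /= jl; split => // i k; rewrite (ord1 k) /ball /=.
  apply: le_lt_trans (Fr j _ i (Fle _ _ jl _ (Fx l))) _.
  by have := jP j (leqnn j); rewrite /= sub0r normrN; exact: le_lt_trans (ler_norm _).
have xy : cvg (x @ \oo) by exact: cauchy_cvg.
exists (lim (x @ \oo)) => // j; apply: (closed_cvg _ (Fc j) _ _ xy).
by exists j => // l /= jl; exact: Fle jl _ (Fx l).
Qed.

(** For [u] in [0, 1), these are the first [j] base-[N] digits of [u], read as one integer. Dividing
    by [N] drops the last digit, that is, passes to the parent node. *)
Definition address (N j : nat) (u : R) : nat := Num.trunc (N%:R ^+ j * u).

Lemma address_itv N j u : 0 <= u ->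
  (address N j u)%:R <= N%:R ^+ j * u < (address N j u).+1%:R.
Proof. by move=> u0; apply: truncn_itv; rewrite mulr_ge0 // exprn_ge0. Qed.

Lemma address0 N u : 0 <= u < 1 -> address N 0 u = 0%N.
Proof.
move=> /andP[u0 u1]; apply/eqP.
by rewrite /address expr0 mul1r truncn_eq // u0.
Qed.

Lemma addressS_div N j u : (0 < N)%N -> 0 <= u ->
  (address N j.+1 u %/ N)%N = address N j u.
Proof.
move=> N0 u0; apply/esym/eqP; rewrite [address N j u]/address truncn_eq; last first.
  by rewrite mulr_ge0 // exprn_ge0.
have N1 : 0 < N%:R :> R by rewrite ltr0n.
have /andP[] := address_itv N j.+1 u0.
move: (address N j.+1 u) => m; rewrite exprS -mulrA => m1 m2; apply/andP; split.
  rewrite -(ler_pM2l N1); apply: le_trans m1; rewrite -natrM ler_nat mulnC.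
  exact: leq_divM.
rewrite -(ltr_pM2l N1); apply: lt_le_trans m2 _; rewrite -natrM ler_nat.
by rewrite mulnC; exact: ltn_ceil.
Qed.

(** Equal addresses at level [j] force [u] and [v] within [N ^- j], so distinct points separate at
    some level; [j] is the level just before the first separation. *)
Lemma address_split N (u v : R) : (1 < N)%N -> 0 <= u < 1 -> 0 <= v < 1 ->
  u != v -> exists j, [/\ address N j u = address N j v,
    address N j.+1 u != address N j.+1 v & `|u - v| <= N%:R ^- j].
Proof.
move=> N1 u01 v01 uv.
have N0 : 0 < N%:R :> R by rewrite ltr0n ltnW.
have near j : address N j u = address N j v -> N%:R ^+ j * `|u - v| < 1.
  move=> e; have /andP[u1 u2] := address_itv N j (proj1 (andP u01)).
  have /andP[v1 v2] := address_itv N j (proj1 (andP v01)).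
  rewrite -[_ ^+ j]ger0_norm ?exprn_ge0 // -normrM mulrBr ltr_norml.
  by move: u1 u2 v1 v2; rewrite e -!natr1; lra.
have [j0 j0P] : exists j, address N j u != address N j v.
  apply/not_existsP => same; have uv0 : 0 < `|u - v| by rewrite normr_gt0 subr_eq0.
  have gt1 : 1 < N%:R :> R by rewrite ltr1n.
  (* At this level [N ^ m > m > 1 / |u - v|], against [near]. *)
  pose m := (Num.trunc (`|u - v|^-1)).+1.
  have := near m (eqP (negbNE (introN idP (same m)))).
  rewrite ltNge => /negP; apply; rewrite -ler_pdivrMr // mul1r.
  apply: le_trans (ltW (truncnS_gt _)) _; rewrite -natrX ler_nat.
  exact/ltnW/ltn_expl.
have [[|j] jP jmin] := ex_minnP (ex_intro (fun j => address N j u != address N j v) j0 j0P).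
  by rewrite !address0 // eqxx in jP.
exists j; have same : address N j u = address N j v.
  by apply/eqP; apply: contraTT (leqnn j) => /jmin; rewrite -ltnNge.
split => //; rewrite -[leRHS]mul1r ler_pdivlMr ?exprn_gt0 // mulrC.
exact/ltW/near.
Qed.

(* The paths of the tree are indexed by the base-[N] expansions of the points
   of [0, 1). *)
Lemma tree_dimension (N : nat) (b g r : R) (P : set 'cV[R]_n)
    (F : nat -> 'cV[R]_n -> set 'cV[R]_n) (G : nat -> set 'cV[R]_n) (x0 : 'cV[R]_n) (A : set 'cV[R]_n) :
  (0 < N)%N -> 0 < b < 1 -> 0 < g -> P x0 ->
  (forall j x, closed (F j x)) -> (forall j x, F j x x) ->
  (forall j x y i, F j x y -> `|x i 0 - y i 0| <= r * b ^+ j) ->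
  (forall j x, P x -> exists f : nat -> 'cV[R]_n,
    (forall i, (i < N)%N ->
       [/\ P (f i), F j.+1 (f i) `<=` F j x & F j.+1 (f i) `<=` G j]) /\
    (forall i i' y y', (i < N)%N -> (i' < N)%N -> i != i' ->
       F j.+1 (f i) y -> F j.+1 (f i') y' -> g * b ^+ j <= eucl_dist y y')) ->
  closure P `&` \bigcap_j G j `<=` A ->
  ((ln N%:R / - ln b)%:E <= hausdorff_dim A)%E.
Proof.
move=> N0 /andP[b0 b1] g0 Px0 Fc Fx Fr child GA.
have lnb : 0 < - ln b by rewrite oppr_gt0 ln_lt0 // b0.
apply: hausdorff_dim_ge => s s0; rewrite ltr_pdivlMr // => sN.
have N1 : (1 < N)%N.
  case: N N0 sN {child} => [//|[|//]] _.
  by rewrite ln1 ltNge mulr_ge0 // ltW.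
(* The condition [P] is moved under the existential so that children can be chosen for every pair of
   a level and a center; off [P] the choice is a dummy. *)
have /choice [ch chP] : forall jx : nat * 'cV[R]_n, exists f : nat -> 'cV[R]_n,
    P jx.2 -> (forall i, (i < N)%N -> [/\ P (f i), F jx.1.+1 (f i) `<=` F jx.1 jx.2
        & F jx.1.+1 (f i) `<=` G jx.1]) /\
    (forall i i' y y', (i < N)%N -> (i' < N)%N -> i != i' ->
       F jx.1.+1 (f i) y -> F jx.1.+1 (f i') y' -> g * b ^+ jx.1 <= eucl_dist y y').
  move=> [j x]; have [/child -/(_ j) [f fP]|nP] := pselect (P x); first by exists f.
  by exists (fun=> x).
(* Center of the node with address [m] at level [j]: the quotient by [N] is the address of the
   parent, the remainder is the number of the child. *)
pose fix ctr (j m : nat) {struct j} : 'cV[R]_n :=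
  if j is j'.+1 then ch (j', ctr j' (m %/ N)%N) (m %% N)%N else x0.
have modN m : (m %% N < N)%N by rewrite ltn_mod.
have Pctr j m : P (ctr j m).
  by elim: j m => [//|j IH] m /=; have [/(_ _ (modN m)) []] := chP (j, _) (IH (m %/ N)%N).
have ctrS j m : F j.+1 (ctr j.+1 m) `<=` F j (ctr j (m %/ N)%N) /\
    F j.+1 (ctr j.+1 m) `<=` G j.
  by have [/(_ _ (modN m)) []] := chP (j, _) (Pctr j (m %/ N)%N).
have node u : exists y, 0 <= u < 1 ->
    [/\ closure P y, forall j, G j y & forall j, F j (ctr j (address N j u)) y].
  have [/andP[u0 u1]|nu] := boolP (0 <= u < 1); last by exists x0.
  have [|j|j|j|j y i|y xy yF] := @nested_limit (fun j => F j (ctr j (address N j u)))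
      (fun j => ctr j (address N j u)) r b.
  - by rewrite gtr0_norm.
  - exact: Fc.
  - by rewrite -(addressS_div j N0 u0); have [] := ctrS j (address N j.+1 u).
  - exact: Fx.
  - exact: Fr.
  exists y => _; split => //.
    by apply: (closed_cvg _ (@closed_closure _ P) _ _ xy); apply: nearW => j; exact: subset_closure.
  by move=> j; have [_] := ctrS j (address N j.+1 u); apply; exact: yF.
have /choice [h hP] := node.
pose C := g^-1 `^ s.
have C0 : 0 < C by rewrite powR_gt0 // invr_gt0.
apply/eqP; rewrite gt_eqF //; apply: (@hausdorff_measure_gt0 _ _ A h C s C0 s0).
  by move=> u u01; apply: GA; have [? ? _] := hP _ u01; split => // j _.
move=> u v u01 v01 uv; have /andP[u0 _] := u01; have /andP[v0 _] := v01.
(* At level [j] the two paths share a node and then enter different children, so the limit points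
   are at least [g * b ^+ j] apart. *)
have [j [same diff uvj]] := address_split N1 u01 v01 uv.
have [_ _ hu] := hP _ u01; have [_ _ hv] := hP _ v01.
have := hu j.+1; have := hv j.+1 => /=.
rewrite !addressS_div // same => hv1 hu1.
have [_ /(_ _ _ _ _ (modN _) (modN _) _ hu1 hv1) /= gap] := chP (j, _) (Pctr j (address N j v)).
have {}gap : g * b ^+ j <= eucl_dist (h u) (h v).
  apply: gap; apply: contra diff => /eqP e.
  by rewrite (divn_eq (address N j.+1 u) N) (divn_eq (address N j.+1 v) N) e
    !addressS_div // same.
apply: le_trans uvj _.
(* This is [s * - ln b < ln N] exponentiated. It yields [|u - v| <= N ^- j <= (b ^+ j) ^ s], and the
   gap bounds the right side by [C] times the distance to the power [s]. *)
have bN : N%:R^-1 <= b `^ s.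
  rewrite /powR gt_eqF // -[leLHS]lnK ?posrE ?invr_gt0 ?ltr0n // ler_expR lnV ?posrE ?ltr0n //.
  by rewrite lerNl -mulrN ltW.
rewrite -exprVn /C -powRM ?invr_ge0 ?eucl_dist_ge0 ?(ltW g0) //.
apply: (@le_trans _ _ ((b `^ s) ^+ j)).
  by apply: lerXn2r; rewrite ?nnegrE ?invr_ge0 ?powR_ge0.
rewrite -powR_mulrn ?powR_ge0 // -powRrM (mulrC s) powRrM powR_mulrn ?(ltW b0) //.
apply: ge0_ler_powR; rewrite ?nnegrE //.
- by rewrite exprn_ge0 // ltW.
- by rewrite mulr_ge0 ?eucl_dist_ge0 // invr_ge0 ltW.
- by rewrite ler_pdivlMl.
Qed.

End CantorTree.

(** * Separated points of the support off hyperplanes *)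

Section Support.
Context {R : realType} {n : nat}.
Variable mu : {measure set (borelRn R n) -> \bar R}.
Implicit Types (A U : set 'cV[R]_n).

Lemma measurable_open_cV U : open U -> measurable (U : set (borelRn R n)).
Proof. exact: sub_sigma_algebra. Qed.

Lemma measurable_closed_cV U : closed U -> measurable (U : set (borelRn R n)).
Proof.
move=> Uc; rewrite -[U]setCK; apply: measurableC; apply: measurable_open_cV.
exact: closed_openC.
Qed.

(** Every point off the support lies in a null ball with rational center and radius [1 / (m + 1)],
    and there are countably many such balls. *)
Lemma negligible_setC_msupport : mu.-negligible (~` msupport mu).
Proof.
pose B (qm : 'cV[rat]_n * nat) : set 'cV[R]_n :=
  interior (ball (map_mx ratr qm.1 : 'cV[R]_n) qm.2.+1%:R^-1).
pose F k : set 'cV[R]_n :=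
  if unpickle k is Some qm then if mu (B qm) == 0%E then B qm else set0 else set0.
have nF : mu.-negligible (\bigcup_k F k).
  apply: negligible_bigcup => k; rewrite /F.
  case: unpickle => [qm|]; last exact: negligible_set0.
  case: ifPn => [/eqP B0|_]; last exact: negligible_set0.
  exists (B qm); split => //; apply: measurable_open_cV; exact: open_interior.
apply: negligibleS nF => x /existsNP[U /not_implyP[Uo /not_implyP[Ux /negP]]].
rewrite -leNgt => U0.
have /nbhs_ballP[e /= e0 eU] : nbhs x U by exact: open_nbhs_nbhs.
(* Then [2 / (m + 1) < e], so a ball of radius [1 / (m + 1)] whose center is within half that radius
   of [x] stays inside [U]. *)
pose m := Num.trunc (2 / e).
have m0 : 0 < m.+1%:R^-1 :> R by rewrite invr_gt0.
have d0 : 0 < m.+1%:R^-1 / 2 :> R by rewrite divr_gt0.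
have me : 2 * m.+1%:R^-1 < e.
  by rewrite ltr_pdivrMr ?ltr0n // mulrC -ltr_pdivrMr //; exact: truncnS_gt.
have /choice [q qP] : forall i, exists q : rat, `|x i 0 - ratr q| < m.+1%:R^-1 / 2.
  move=> i; have /rat_in_itvoo [q] : x i 0 - m.+1%:R^-1 / 2 < x i 0 + m.+1%:R^-1 / 2.
    by rewrite ltrD2l (lt_trans _ d0) // oppr_lt0.
  by rewrite in_itv /= => /andP[q1 q2]; exists q; rewrite distrC ltr_distl q1.
pose qm : 'cV[rat]_n * nat := (\col_i q i, m).
have qx : ball (map_mx ratr qm.1 : 'cV[R]_n) (m.+1%:R^-1 / 2) x.
  split; first exact: divr_gt0.
  by move=> i j; rewrite (ord1 j) !mxE; apply: ball_sym; exact: qP.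
have Bx : B qm x.
  apply: (@filterS _ _ (nbhs_filter x) (ball x (m.+1%:R^-1 / 2))).
    by move=> y xy; rewrite [m.+1%:R^-1]splitr; exact: ball_triangle qx xy.
  by apply: nbhsx_ballx; rewrite divr_gt0.
exists (pickle qm) => //; rewrite /F pickleK.
suff -> : mu (B qm) = 0%E by rewrite eqxx.
apply/eqP; rewrite eq_le measure_ge0 andbT; apply: le_trans U0.
apply: le_measure; rewrite ?inE; [|exact: measurable_open_cV|].
  by apply: measurable_open_cV; exact: open_interior.
apply: subset_trans (@interior_subset _ _) _ => y qy; apply: eU.
have : ball x (m.+1%:R^-1 / 2 + m.+1%:R^-1) y by apply: ball_triangle (ball_sym qx) qy.
apply: le_ball; move: me m0; move: (m.+1%:R^-1) => d; lra.
Qed.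

Lemma measure_gt0_meets_msupport A : measurable (A : set (borelRn R n)) ->
  (0 < mu A)%E -> (A `&` msupport mu) !=set0.
Proof.
move=> mA; rewrite lt0e => /andP[/eqP A0 _]; apply: contrapT => nAX; apply: A0.
apply/(negligibleP _ mA)/(negligibleS _ negligible_setC_msupport).
by move=> x Ax Xx; apply: nAX; exists x.
Qed.

Lemma closed_msupport : closed (msupport mu).
Proof.
move=> x xX U Uo Ux; have /xX [y [Xy Uy]] : nbhs x U by exact: open_nbhs_nbhs.
exact: Xy.
Qed.

End Support.

(** * Greedy choice of children for a decaying measure *)

Section MeasureAvoidance.
Context {R : realType} {n : nat}.
Variable mu : {measure set (borelRn R n) -> \bar R}.

(** A union bound without subtraction, so infinite values do no harm. The sets are removed from [B]
    one at a time, which is why [B] varies in the induction. *)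
Lemma measure_le_avoid (I : eqType) (s : seq I) (E : I -> set 'cV[R]_n) (B : set 'cV[R]_n) :
  (forall i, measurable (E i : set (borelRn R n))) -> measurable (B : set (borelRn R n)) ->
  measurable (B `&` [set y | forall i, i \in s -> ~ E i y] : set (borelRn R n)) /\
  (mu B <= mu (B `&` [set y | forall i, i \in s -> ~ E i y]) +
           \sum_(i <- s) mu (B `&` E i))%E.
Proof.
move=> mE; elim: s B => [|j s IH] B mB.
  rewrite (_ : B `&` _ = B); first by rewrite big_nil adde0; split.
  by apply/seteqP; split => [y []//|y By]; split.
have mBj : measurable (B `\` E j : set (borelRn R n)) by exact: measurableD.
have [IH1 IH2] := IH _ mBj.
have -> : B `&` [set y | forall i, i \in j :: s -> ~ E i y] =
    (B `\` E j) `&` [set y | forall i, i \in s -> ~ E i y].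
  apply/seteqP; split => [y [By /= yE]|y [[By yj] /= ys]].
    split; first by split => //; apply: yE; rewrite mem_head.
    by move=> i si; apply: yE; rewrite in_cons si orbT.
  by split => // i; rewrite in_cons => /orP[/eqP ->//|]; exact: ys.
split => //; rewrite (measureDI mu mB (mE j)) big_cons addeCA addeC leeD2r //.
apply: le_trans IH2 _; rewrite leeD2l //; apply: lee_sum => i _.
apply: le_measure; rewrite ?inE; [exact: measurableI|exact: measurableI|].
by move=> y [[]].
Qed.

(** Greedy choice: the slabs take at most a fraction [q] of the ball, and each point already chosen
    excludes a ball of radius [4 * expR (- (t + c))], whose measure the power law bounds. While the
    total stays below the measure of the ball, the remainder has positive measure and meets the
    support. The bound on [N] is stated for all [m < N] so that it passes to the induction. *)
Lemma separated_children (X : set 'cV[R]_n) (ts : \bar R) (tau ctau delta c1 c2 : R)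
    (x : 'cV[R]_n) (t c p : R) (S : seq ('cV[R]_n * R)) (N : nat) :
  X = msupport mu -> absolutely_decaying mu X ts tau ctau ->
  power_law mu X ts delta c1 c2 ->
  X x -> (ts < t%:E)%E -> ln 4 <= c -> 0 < ctau -> 0 < c1 ->
  (size S)%:R <= p -> (forall s, s \in S -> s.1 != 0) ->
  ctau * 2 `^ tau * p * expR (- (tau * c)) <= 1 ->
  (forall m, (m < N)%N -> m%:R * (c2 * expR (- (delta * (c - ln 4)))) <
     (1 - ctau * 2 `^ tau * p * expR (- (tau * c))) * c1) ->
  exists f : nat -> 'cV[R]_n, forall i, (i < N)%N ->
    [/\ X (f i), eucl_dist x (f i) <= expR (- t),
      forall s, s \in S ->
        2 * expR (- (t + c)) * eucl_norm s.1 < `|dotv s.1 (f i) - s.2| &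
      forall j, (j < i)%N -> 4 * expR (- (t + c)) < eucl_dist (f j) (f i)].
Proof.
move=> XE dec pow Xx tst c4 ctau0 c10 Sp S0 q1.
set q := ctau * 2 `^ tau * p * expR (- (tau * c)) in q1 *.
elim: N => [|N IH] NP; first by exists (fun=> 0).
have [m mN|f fP] := IH; first by apply: NP; exact: ltnW.
have ln4 : 0 <= ln (4 : R) by rewrite ln_ge0 // ler1n.
have ln2 : ln 4 = 2 * ln 2 :> R.
  by rewrite (_ : 4 = 2 ^+ 2) ?lnXn ?mulr_natl // -natrX.
pose B := eucl_ball x (expR (- t)).
pose E (s : 'cV[R]_n * R) :=
  [set y | `|dotv s.1 y - s.2| <= 2 * expR (- (t + c)) * eucl_norm s.1].
pose E' i := eucl_ball (f i) (4 * expR (- (t + c))).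
have mB : measurable (B : set (borelRn R n)).
  by apply: measurable_closed_cV; exact: closed_eucl_ball.
have mE s : measurable (E s : set (borelRn R n)).
  by apply: measurable_closed_cV; exact: closed_slab.
have mE' i : measurable (E' i : set (borelRn R n)).
  by apply: measurable_closed_cV; exact: closed_eucl_ball.
have [mB1 leB] := measure_le_avoid S mE mB.
set B1 := B `&` _ in mB1 leB.
have [mB2 leB1] := measure_le_avoid (iota 0 N) mE' mB1.
set B2 := B1 `&` _ in mB2 leB1.
(* [B2] is the ball minus the slabs and minus the balls around the first [N] points; a point of the
   support in it becomes child number [N]. *)
suff : (0 < mu B2)%E.
  case/(measure_gt0_meets_msupport mB2) => y [[[By yS] yf] Xy].
  exists (fun i => if (i < N)%N then f i else y) => i.
  rewrite ltnS leq_eqVlt => /orP[/eqP ->|iN].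
    rewrite ltnn; split => //; first by rewrite XE.
      by move=> s sS; rewrite ltNge; apply/negP; exact: yS.
    move=> j jN; rewrite jN ltNge; apply/negP; apply: yf.
    by rewrite mem_iota add0n jN.
  rewrite iN; have [? ? ? fi] := fP i iN; split => // j ji.
  by rewrite (ltn_trans ji iN); exact: fi.
rewrite lt0e measure_ge0 andbT; apply/eqP => B20.
have [lo hi] := pow _ _ Xx tst; rewrite -/B in lo hi.
have [v vE] : exists v : R, mu B = v%:E.
  move: lo hi; case: (mu B) => [v _ _|//|//]; first by exists v.
rewrite vE !lee_fin in lo hi.
have slab s : s \in S -> (mu (B `&` E s) <=
    (ctau * 2 `^ tau * expR (- (tau * c)) * v)%:E)%E.
  move=> sS; have s0 := S0 _ sS.
  (* The half-width [2 * expR (- (t + c))] is [expR (- (t + (c - ln 2)))]; the shift by [ln 2]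
     produces the factor [2 ^ tau]. *)
  have := dec x t (c - ln 2) [set y | \sum_i s.1 i 0 * y i 0 = s.2] Xx tst.
  rewrite eucl_nbhd_hyperplane // -/B vE => /(_ _ _)/le_trans.
  have <- : E s = [set y | `|dotv s.1 y - s.2| <=
      eucl_norm s.1 * expR (- (t + (c - ln 2)))].
    rewrite /E; congr [set y | _ <= _]; rewrite mulrC; congr (_ * _).
    by rewrite addrA opprB expRD lnK ?posrE.
  apply; last 2 first.
  - by exists s.1, s.2.
  - rewrite -EFinM lee_fin; have -> //: ctau * expR (- (tau * (c - ln 2))) =
       ctau * 2 `^ tau * expR (- (tau * c)).
    rewrite /powR ifF ?pnatr_eq0 // -mulrA -expRD; congr (_ * expR _); ring.
  - by lra.
have ball i : (i < N)%N -> (mu (B1 `&` E' i) <=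
    (c2 * expR (- (delta * (t + c - ln 4))))%:E)%E.
  move=> iN; have [Xf _ _ _] := fP i iN.
  apply: (@le_trans _ _ (mu (E' i))); first exact: measureIr.
  have -> : E' i = eucl_ball (f i) (expR (- (t + c - ln 4))).
    by rewrite /E' opprB expRD lnK ?posrE.
  apply: (pow _ _ Xf _).2; apply: lt_le_trans tst _; rewrite lee_fin; lra.
have sumE : (\sum_(s <- S) mu (B `&` E s) <= (q * v)%:E)%E.
  apply: (@le_trans _ _ (\sum_(s <- S) (ctau * 2 `^ tau * expR (- (tau * c)) * v)%:E)%E).
    by rewrite big_seq [leRHS]big_seq; apply: lee_sum => s; exact: slab.
  rewrite sumEFin lee_fin big_const_seq count_predT iter_addr_0 -[leLHS]mulr_natr.
  rewrite /q; have v0 : 0 <= v by apply: le_trans lo; rewrite mulr_ge0 ?expR_ge0 ?ltW.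
  have -> : ctau * 2 `^ tau * p * expR (- (tau * c)) * v =
     (ctau * 2 `^ tau * expR (- (tau * c)) * v) * p by ring.
  by rewrite ler_wpM2l // !mulr_ge0 ?powR_ge0 ?expR_ge0 // ltW.
have sumE' : (\sum_(i <- iota 0 N) mu (B1 `&` E' i) <=
    (N%:R * (c2 * expR (- (delta * (t + c - ln 4)))))%:E)%E.
  apply: (@le_trans _ _ (\sum_(i <- iota 0 N) (c2 * expR (- (delta * (t + c - ln 4))))%:E)%E).
    rewrite big_seq [leRHS]big_seq; apply: lee_sum => i.
    by rewrite mem_iota add0n => /ball.
  rewrite sumEFin lee_fin big_const_seq count_predT iter_addr_0 size_iota.
  by rewrite -[leLHS]mulr_natl.
(* If [B2] were null, then [(1 - q) * v] would be at most the measure of the excluded balls,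
   contradicting [NP] at [m = N] and the lower power law for [v]. *)
have : (mu B <= (N%:R * (c2 * expR (- (delta * (t + c - ln 4)))))%:E + (q * v)%:E)%E.
  apply: le_trans leB _; apply: leeD => //; apply: le_trans leB1 _.
  by rewrite B20 add0e.
rewrite vE -EFinD lee_fin.
have -> : expR (- (delta * (t + c - ln 4))) =
    expR (- (delta * (c - ln 4))) * expR (- (delta * t)) by rewrite -expRD; congr expR; ring.
have := NP N (ltnSn N); have e0 := expR_gt0 (- (delta * t)).
move: lo; set u := expR (- (delta * t)) in e0 *; set w := expR _ => lo NN.
have : N%:R * (c2 * w) * u < (1 - q) * c1 * u by rewrite ltr_pM2r.
have : (1 - q) * (c1 * u) <= (1 - q) * v by rewrite ler_wpM2l // subr_ge0.
lra.
Qed.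

End MeasureAvoidance.

(** * Cells of a cube off hyperplanes *)

Section Cells.
Context {R : realType} {n : nat}.

Lemma coordB (x y : 'cV[R]_n) i : (x - y) i 0 = x i 0 - y i 0.
Proof. by rewrite !mxE. Qed.

Definition cube (x : 'cV[R]_n) (h : R) : set 'cV[R]_n :=
  [set y | forall i, `|x i 0 - y i 0| <= h].

Lemma closed_cube x h : closed (cube x h).
Proof.
have -> : cube x h =
    \bigcap_i [set y | `|dotv (delta_mx i 0) y - x i 0| <= h].
  have di i (y : 'cV[R]_n) : dotv (delta_mx i 0) y = y i 0.
    rewrite /dotv (bigD1 i) //= mxE !eqxx mul1r big1 ?addr0 // => j ji.
    by rewrite mxE (negbTE ji) mul0r.
  apply/seteqP; split => [y xy i _|y xy i] /=; first by rewrite di distrC.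
  by have := xy i I; rewrite /= di distrC.
by apply: closed_bigI => i _; exact: closed_slab.
Qed.

Lemma eucl_dist_cube x h y y' : 0 <= h -> cube x h y -> cube x h y' ->
  eucl_dist y y' <= n%:R * (2 * h).
Proof.
move=> h0 xy xy'; apply: eucl_norm_le_sup => [|i]; first by rewrite mulr_ge0.
rewrite !mxE; have := ler_distD (x i 0) (y i 0) (y' i 0).
by have := xy i; have := xy' i; rewrite (distrC (y i 0) (x i 0)); lra.
Qed.

(* The cube of half-side [h] is cut into [K ^ n] cells of half-side [h / K]. *)
Definition cell_center (K : nat) (x : 'cV[R]_n) (h : R) (m : {ffun 'I_n -> 'I_K}) : 'cV[R]_n :=
  \col_i (x i 0 + h * ((2 * (m i)%:R + 1) / K%:R - 1)).

Lemma cell_center_sub K x h (m m' : {ffun 'I_n -> 'I_K}) i :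
  cell_center x h m i 0 - cell_center x h m' i 0 =
  2 * h / K%:R * ((m i)%:R - (m' i)%:R).
Proof. rewrite !mxE; ring. Qed.

Lemma cell_center_gap K x h (m m' : {ffun 'I_n -> 'I_K}) : 0 <= h -> m != m' ->
  exists i, 2 * h / K%:R <= `|cell_center x h m i 0 - cell_center x h m' i 0|.
Proof.
move=> h0 mm'; have [i mi] : exists i, m i != m' i.
  by apply/existsP; apply: contraNT mm' => /existsPn mm; apply/eqP/ffunP => i; exact/eqP/negPn/mm.
exists i; rewrite cell_center_sub normrM ger0_norm ?divr_ge0 ?mulr_ge0 //.
rewrite ler_peMr ?divr_ge0 ?mulr_ge0 //.
have : (m i : nat) != m' i by rewrite (inj_eq val_inj).
wlog lt : m m' {mm' mi} / (m i < m' i)%N.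
  move=> H; rewrite neq_ltn => /orP[lt|lt]; last rewrite distrC.
    by apply: H => //; rewrite ltn_eqF.
  by apply: H => //; rewrite ltn_eqF.
move=> _; rewrite distrC ger0_norm ?subr_ge0 ?ler_nat ?(ltnW lt) //.
by rewrite lerBrDr addrC natr1 ler_nat.
Qed.

(** Along each axis a cell center is within [h - h / K] of [x], and [h / (K + 1)] is less than the
    half-side [h / K] of a cell. *)
Lemma cell_sub_cube K x h (m : {ffun 'I_n -> 'I_K}) : 0 <= h ->
  cube (cell_center x h m) (h / K.+1%:R) `<=` cube x h.
Proof.
move=> h0 y my i; have K0 : 0 < K%:R :> R.
  by rewrite ltr0n; case: (K) (m i) => [[]|].
have m0 : 0 <= (m i)%:R :> R by [].
have mK : (m i)%:R + 1 <= K%:R :> R by rewrite natr1 ler_nat.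
have hK : h / K.+1%:R <= h / K%:R.
  by rewrite ler_wpM2l // lef_pV2 ?posrE ?ltr0n ?ler_nat // -(ltr0n R).
apply: le_trans (ler_distD (cell_center x h m i 0) _ _) _.
have xc : `|x i 0 - cell_center x h m i 0| <= h - h / K%:R.
  rewrite mxE opprD addrA subrr sub0r normrN normrM ger0_norm //.
    have -> : h - h / K%:R = h * (1 - K%:R^-1) by ring.
    rewrite ler_wpM2l // ler_norml; apply/andP; split.
      rewrite -subr_ge0; have -> : (2 * (m i)%:R + 1) / K%:R - 1 - - (1 - K%:R^-1) =
        2 * (m i)%:R / K%:R :> R by ring.
      by rewrite divr_ge0 // mulr_ge0.
    rewrite -subr_ge0; have -> : 1 - K%:R^-1 - ((2 * (m i)%:R + 1) / K%:R - 1) =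
      2 * (K%:R - ((m i)%:R + 1)) / K%:R :> R by field; rewrite gt_eqF.
    by rewrite divr_ge0 // mulr_ge0 // subr_ge0.
by apply: le_trans (lerD xc (le_trans (my i) hK)) _; rewrite subrK.
Qed.

(* Along the axis where [a] has its largest coordinate, a slab normal to [a]
   contains the centers of fewer than [n * W] consecutive cells. *)
Lemma card_cells_slab K x h (a : 'cV[R]_n) (b : R) (W : nat) :
  0 < h -> a != 0 -> (0 < W)%N ->
  (#|[set m : {ffun 'I_n -> 'I_K} | (`|dotv a (cell_center x h m) - b| <
      eucl_norm a * (W%:R * h / K%:R))%R]%SET| <= n * W * K ^ n.-1)%N.
Proof.
move=> h0 a0 W0; have [i0 _] : exists i : 'I_n, a i 0 != 0.
  apply/existsP; apply: contraNT a0 => /existsPn a0; apply/eqP/matrixP => i j.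
  by rewrite (ord1 j) mxE; exact/eqP/negPn/a0.
(* With [p] the axis of the largest coordinate, [eucl_norm a <= n * |a p|]; this is the source of
   the factor [n]. *)
have [p _ pmax] := @arg_maxP _ _ _ i0 predT (fun i => `|a i 0|) isT.
have ap : 0 < `|a p 0|.
  rewrite lt_neqAle normr_ge0 andbT eq_sym; apply: contraNneq a0 => ap.
  apply/eqP/matrixP => i j; rewrite (ord1 j) mxE; apply/normr0_eq0/le_anti.
  by rewrite normr_ge0 andbT -ap; exact: pmax.
have ale : eucl_norm a <= n%:R * `|a p 0|.
  by apply: eucl_norm_le_sup => // i; exact: pmax.
have n0 : (0 < n)%N by case: (n) i0 => [[]|].
have D0 : (0 < n * W)%N by rewrite muln_gt0 n0.
set A := [set m | _]%SET.
(* The slab pins down the index along [p] once it is known modulo [n * W]; the other indices are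
   free, which gives [n * W * K ^ n.-1] values. *)
pose g (m : {ffun 'I_n -> 'I_K}) : 'I_(n * W) * {ffun {i : 'I_n | i != p} -> 'I_K} :=
  (Ordinal (ltn_pmod (m p) D0), [ffun i => m (val i)]).
have ginj : {in A &, injective g}.
  move=> m m'; rewrite !inE => mA m'A [mp /ffunP moff].
  have off i : i != p -> m i = m' i.
    by move=> ip; have := moff (exist _ i ip); rewrite !ffunE.
  suff mpe : m p = m' p by apply/ffunP => i; have [->//|/off] := eqVneq i p.
  have K0 : 0 < K%:R :> R by rewrite ltr0n; case: (K) (m p) => [[]|].
  have dE : dotv a (cell_center x h m) - dotv a (cell_center x h m') =
      a p 0 * (2 * h / K%:R * ((m p)%:R - (m' p)%:R)).
    have dc i : (cell_center x h m - cell_center x h m') i 0 =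
        2 * h / K%:R * ((m i)%:R - (m' i)%:R).
      by rewrite coordB cell_center_sub.
    rewrite -dotvBr /dotv (bigD1 p) //= big1 ?addr0 => [|i ip]; first by rewrite dc.
    by rewrite dc off // subrr !mulr0.
  (* Two centers in the slab that agree off [p] have indices along [p] differing by less than
     [n * W], so equal residues mean equal indices. *)
  have lt : `|(m p)%:R - (m' p)%:R| < (n * W)%:R :> R.
    have : `|a p 0 * (2 * h / K%:R * ((m p)%:R - (m' p)%:R))| <
        2 * (n%:R * `|a p 0| * (W%:R * h / K%:R)).
      rewrite -dE; apply: le_lt_trans (ler_distD b _ _) _.
      have aW : eucl_norm a * (W%:R * h / K%:R) <=
          n%:R * `|a p 0| * (W%:R * h / K%:R).
        by rewrite ler_wpM2r // divr_ge0 // mulr_ge0 // ltW.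
      rewrite (distrC b) [ltRHS]mulr_natl mulr2n.
      exact: ltrD (lt_le_trans mA aW) (lt_le_trans m'A aW).
    have -> : 2 * (n%:R * `|a p 0| * (W%:R * h / K%:R)) =
       (`|a p 0| * (2 * h / K%:R)) * (n * W)%:R by rewrite natrM; ring.
    rewrite mulrA normrM normrM [X in _ * X * _]ger0_norm ?divr_ge0 ?mulr_ge0 // ?ltW //.
    by rewrite ltr_pM2l // mulr_gt0 // divr_gt0 // mulr_gt0.
  have mod : (m p = m' p %[mod n * W])%N by exact: mp.
  apply: val_inj; move: lt mod => /=; move: (m p : nat) (m' p : nat) => q q'.
  wlog : q q' / (q' <= q)%N.
    move=> H lt e; case: (leqP q' q) => [|/ltnW] qq; first exact: H.
    by apply/esym/H => //; rewrite distrC.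
  move=> qq; rewrite -natrB // normr_nat ltr_nat => lt /eqP.
  rewrite eqn_mod_dvd // => /dvdnP[[|k] e].
    by apply/eqP; rewrite eqn_leq qq andbT -subn_eq0 e.
  by move: lt; rewrite e mulSn ltnNge leq_addr.
rewrite -(card_in_imset ginj); apply: leq_trans (max_card _) _.
rewrite card_prod card_ord card_ffun card_ord card_sig.
by rewrite (eq_card (B := predC1 p)) // cardC1 card_ord.
Qed.

(** A union bound over the slabs: all but [p * (n * W * K ^ n.-1)] of the [K ^ n] cells are good,
    and the good ones are enumerated. *)
Lemma separated_cells K x h (p : R) (S : seq ('cV[R]_n * R)) (W N : nat) :
  (0 < K)%N -> 0 < h -> (0 < W)%N ->
  (size S)%:R <= p -> (forall s, s \in S -> s.1 != 0) ->
  (forall m, (m < N)%N -> m%:R < K%:R ^+ n - p * (n * W * K ^ n.-1)%:R) ->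
  exists f : nat -> {ffun 'I_n -> 'I_K},
    (forall i j, (i < N)%N -> (j < N)%N -> i != j -> f i != f j) /\
    (forall i s, (i < N)%N -> s \in S ->
      eucl_norm s.1 * (W%:R * h / K%:R) <= `|dotv s.1 (cell_center x h (f i)) - s.2|).
Proof.
move=> K0 h0 W0 Sp S0 NP.
pose bad (s : 'cV[R]_n * R) (m : {ffun 'I_n -> 'I_K}) :=
  `|dotv s.1 (cell_center x h m) - s.2| < eucl_norm s.1 * (W%:R * h / K%:R).
pose good : {set {ffun 'I_n -> 'I_K}} := [set m | ~~ has (bad^~ m) S]%SET.
have badS : (#|(~: good)%SET| <= size S * (n * W * K ^ n.-1))%N.
  have -> : (~: good = [set m | has (bad^~ m) S])%SET.
    by apply/setP => m; rewrite !inE negbK.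
  elim: S S0 {Sp good} => [|s S IH] S0.
    by rewrite (_ : [set m | _]%SET = finset.set0) ?cards0 //; apply/setP => m; rewrite !inE.
  have -> : ([set m | has (bad^~ m) (s :: S)] =
      [set m | bad s m] :|: [set m | has (bad^~ m) S])%SET.
    by apply/setP => m; rewrite !inE.
  apply: leq_trans (leq_card_setU _ _) _; rewrite mulSn leq_add //.
    by apply: card_cells_slab => //; apply: S0; rewrite mem_head.
  by apply: IH => s' s'S; apply: S0; rewrite in_cons s'S orbT.
have Ngood : (N <= #|good|)%N.
  (* If there were fewer than [N] good cells, their number would itself be an admissible [m],
     contradicting the count. *)
  rewrite leqNgt; apply/negP => /NP; apply/negP; rewrite -leNgt.
  rewrite lerBlDr; apply: (@le_trans _ _ (#|good| + #|(~: good)%SET|)%:R).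
    by rewrite cardsC card_ffun !card_ord natrX.
  rewrite natrD lerD2l; apply: le_trans (_ : (size S)%:R * (n * W * K ^ n.-1)%:R <= _).
    by rewrite -natrM ler_nat.
  by rewrite ler_wpM2r.
exists (nth [ffun=> Ordinal K0] (enum good)); split.
  move=> i j iN jN ij; rewrite nth_uniq ?enum_uniq // -cardE.
    exact: leq_trans iN Ngood.
  exact: leq_trans jN Ngood.
move=> i s iN sS; rewrite leNgt; apply/negP => b.
have : nth [ffun=> Ordinal K0] (enum good) i \in good.
  by rewrite -mem_enum mem_nth // -cardE; exact: leq_trans iN Ngood.
by rewrite inE => /hasPn/(_ s sS); rewrite /bad b.
Qed.

End Cells.

(** * The two lower bounds *)

Section Auxiliary.
Context {R : realType}.

(** The ceiling of [a], in the form in which the counting lemmas take the number of children. *)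
Lemma least_natural_ge (a : R) : 0 < a ->
  exists N, [/\ (0 < N)%N, a <= N%:R & forall m, (m < N)%N -> m%:R < a].
Proof.
move=> a0; have [j0 j0P] : exists j, a <= j%:R.
  by exists (Num.bound a); exact/ltW/archi_boundP/ltW.
have [j jl jmin] := ex_minnP (ex_intro (fun j => a <= j%:R) j0 j0P).
exists j; split => //; first by rewrite -(ltr0n R) (lt_le_trans a0).
by move=> m; rewrite ltNge => mj; apply: contraTN mj => /jmin; rewrite -leqNgt.
Qed.

(** Since [ln B < (tau - taubar) * c], decay beats the growth of [p]. This keeps the arguments of
    the logarithms in the final bounds positive. *)
Lemma exponential_decay_lt1 (B p tau taubar c : R) : 0 < B -> taubar < tau ->
  `|ln B| / (tau - taubar) < c -> p <= expR (taubar * c) ->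
  B * p * expR (- (tau * c)) < 1.
Proof.
move=> B0 tt; rewrite ltr_pdivrMr ?subr_gt0 // => Bc pe.
apply: (@le_lt_trans _ _ (B * expR (taubar * c) * expR (- (tau * c)))).
  by rewrite ler_wpM2r ?expR_ge0 // ler_wpM2l // ltW.
rewrite -[B]lnK ?posrE // -!expRD -[ltRHS]expR0 ltr_expR.
have := ler_norm (ln B); lra.
Qed.

Lemma bernoulli_ineq (x : R) m : 0 <= x <= 1 -> 1 - m%:R * x <= (1 - x) ^+ m.
Proof.
move=> /andP[x0 x1]; elim: m => [|m IH]; first by rewrite mul0r subr0 expr0.
rewrite exprS -natr1; apply: (@le_trans _ _ ((1 - x) * (1 - m%:R * x))).
  have : 0 <= m%:R * (x * x) by rewrite !mulr_ge0.
  lra.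
by rewrite ler_wpM2l // subr_ge0.
Qed.

Lemma counting_seq (A : set nat) (r : R) : (@counting nat R A <= r%:E)%E ->
  exists2 ks : seq nat, (forall k, A k -> k \in ks) & (size ks)%:R <= r.
Proof.
rewrite /counting; case: ifPn => [/asboolP fA|_]; last by rewrite leye_eq.
rewrite lee_fin => sr; exists (finmap.enum_fset (fset_set A)) => // k Ak.
have -> : (k \in finmap.enum_fset (fset_set A)) = (k \in A) := in_fset_set fA k.
by rewrite inE.
Qed.

(** The windows of length [c] ending at [T + j * c] tile everything above [T - c]; the least [j]
    with [l <= T + j * c] is the right one. *)
Lemma window_cover (T c l : R) : 0 < c -> T - c < l ->
  exists j, T + j%:R * c - c < l <= T + j%:R * c.
Proof.
move=> c0 Tl.
have [j0 j0P] : exists j, l <= T + j%:R * c.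
  exists (Num.bound `|(l - T) / c|); rewrite -lerBlDl -ler_pdivrMr //.
  exact: le_trans (ler_norm _) (ltW (archi_boundP (normr_ge0 _))).
have [j jl jmin] := ex_minnP (ex_intro (fun j => l <= T + j%:R * c) j0 j0P).
exists j; rewrite jl andbT; case: j jl jmin => [_ _|j _ jmin].
  by rewrite mul0r addr0.
have := contraNN (jmin j); rewrite ltnn => /(_ isT).
by rewrite -ltNge -[j.+1%:R]natr1; lra.
Qed.

End Auxiliary.

Section LowerBounds.
Context {R : realType} (n : nat) (n_gt0 : (0 < n)%N) (M : nat -> 'M[R]_n).
Context (tauk : nat -> R) (Z : nat -> set 'cV[R]_n) (phi : R -> R) (ss : R).
Context (M_unit : forall k, M k \in unitmx).
Context (tauk_gt0 : forall k, 0 < tauk k).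
Context (Z_sep : forall k, eucl_separated (tauk k) (Z k)).
Context (phi_count : forall c t : R, 0 < c -> 0 < t ->
  (@counting nat R [set k | (t - c < ln (opnorm (M k) / tauk k) <= t)%R]
    <= (phi c)%:E)%E).
Context (log_ge : forall k, ss <= ln (opnorm (M k) / tauk k)).

(** One slab for each [k] in the window. There [opnorm (M k) <= expR T * tauk k] makes the image of
    [Y] small enough for [avoid_slab], and [expR (T - c) * tauk k <= opnorm (M k)] bounds the width
    of the slab by [w]. *)
Lemma window_slabs (T c d e w : R) (Y : set 'cV[R]_n) :
  0 < c -> 0 < T -> 0 <= d -> 0 <= e -> expR T * d + 2 * e <= 1 ->
  2 * e * expR (c - T) <= w ->
  (forall y y', Y y -> Y y' -> eucl_dist y y' <= d) ->
  exists S : seq ('cV[R]_n * R), [/\ (size S)%:R <= phi c,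
    forall s, s \in S -> s.1 != 0 &
    forall y, Y y ->
      (forall s, s \in S -> w * eucl_norm s.1 <= `|dotv s.1 y - s.2|) ->
      forall k, T - c < ln (opnorm (M k) / tauk k) <= T ->
        ((e * tauk k)%:E <= eucl_dist_set (M k *m y) (Z k))%E].
Proof.
move=> c0 T0 d0 e0 small ew Yd.
have [ks ksP ksize] := counting_seq (phi_count c0 T0).
have /choice [g gP] : forall k, exists s : 'cV[R]_n * R, s.1 != 0 /\
    (T - c < ln (opnorm (M k) / tauk k) <= T ->
     forall y, Y y -> w * eucl_norm s.1 <= `|dotv s.1 y - s.2| ->
       ((e * tauk k)%:E <= eucl_dist_set (M k *m y) (Z k))%E).
  move=> k; have Mk := opnorm_gt0 n_gt0 (M_unit k).
  have tk := tauk_gt0 k.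
  have [/andP[kl kh]|nk] := boolP (T - c < ln (opnorm (M k) / tauk k) <= T); last first.
    (* For [k] outside the window only a nonzero normal is required. *)
    exists (const_mx 1, 0); split => //=; apply/eqP.
    by move=> /matrixP/(_ (Ordinal n_gt0) 0); rewrite !mxE => /eqP; rewrite oner_eq0.
  have hi : opnorm (M k) <= expR T * tauk k.
    by rewrite -ler_pdivrMr // -[leLHS]lnK ?posrE ?divr_gt0 // ler_expR.
  have lo : expR (T - c) * tauk k <= opnorm (M k).
    by rewrite -ler_pdivlMr // -[leRHS]lnK ?posrE ?divr_gt0 // ler_expR ltW.
  have sm : opnorm (M k) * d + 2 * (e * tauk k) <= tauk k.
    have : opnorm (M k) * d <= expR T * tauk k * d by rewrite ler_wpM2r.
    have : (expR T * d + 2 * e) * tauk k <= 1 * tauk k by rewrite ler_wpM2r // ltW.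
    lra.
  have [a [b [a0 ab]]] := avoid_slab Mk (@Z_sep k) Yd sm.
  exists (a, b); split => //= _ y Yy yw; apply: ab => //; apply: le_trans yw.
  rewrite ler_wpM2r ?eucl_norm_ge0 // ler_pdivrMr //.
  apply: le_trans (_ : 2 * e * expR (c - T) * (expR (T - c) * tauk k) <= _).
    have e1 : expR (c - T) * expR (T - c) = 1.
      by rewrite -expRD addrC addrA subrK subrr expR0.
    have -> : 2 * e * expR (c - T) * (expR (T - c) * tauk k) =
      2 * (e * tauk k) * (expR (c - T) * expR (T - c)) by ring.
    by rewrite e1 mulr1.
  by apply: ler_pM => //; rewrite ?mulr_ge0 ?expR_ge0 // ltW.
exists (map g ks); split; first by rewrite size_map.
  by move=> _ /mapP[k _ ->]; have [] := gP k.
move=> y Yy far k kw; have [_ /(_ kw y Yy)] := gP k; apply; apply: far.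
by apply: map_f; exact: ksP.
Qed.

(** Some logarithm is positive, since otherwise a single window would hold all of the infinitely
    many [k]; the window ending at that logarithm contains its own [k]. *)
Lemma phi_ge1 (c : R) : 0 < c -> 1 <= phi c.
Proof.
move=> c0.
have [k k0] : exists k, 0 < ln (opnorm (M k) / tauk k).
  apply/not_existsP => neg.
  have c1 : 0 < `|ss| + 2 by rewrite ltr_wpDl.
  have [ks ksP _] := counting_seq (phi_count c1 ltr01).
  pose m := (\max_(k <- ks) k).+1.
  have : (m <= \max_(k <- ks) k)%N.
    apply: (@leq_bigmax_seq _ ks predT id m) => //; apply: ksP => /=.
    have := neg m; have := log_ge m; have := ler_norm (- ss); rewrite normrN.
    by move=> h1 h2 /negP; rewrite -leNgt => h3; apply/andP; split; lra.
  by rewrite ltnn.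
have [ks ksP ksize] := counting_seq (phi_count c0 k0).
apply: le_trans ksize; rewrite ler1n.
have /ksP : [set k' | ln (opnorm (M k) / tauk k) - c < ln (opnorm (M k') / tauk k') <=
    ln (opnorm (M k) / tauk k)] k by rewrite /= lexx andbT ltrBlDr ltrDl.
by case: (ks).
Qed.

(** The tree has ratio [expR (- c)] and nodes that are balls of radius [5 / 4 * rho j] centered in
    [X]. The factor [5 / 4] leaves room for children centered within [rho j] of the parent
    center. *)
Lemma decaying_dimension (ts : \bar R) (mu : {measure set (borelRn R n) -> \bar R})
    (X : set 'cV[R]_n) (tau ctau delta c1 c2 c : R) (N : nat) :
  (ts < ss%:E)%E -> X = msupport mu -> X !=set0 ->
  0 < ctau -> absolutely_decaying mu X ts tau ctau ->
  0 < c1 -> power_law mu X ts delta c1 c2 ->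
  ln 5 <= c -> 2 * `|ss| + 1 < c ->
  ctau * 2 `^ tau * phi c * expR (- (tau * c)) <= 1 -> (0 < N)%N ->
  (forall m, (m < N)%N -> m%:R * (c2 * expR (- (delta * (c - ln 4)))) <
     (1 - ctau * 2 `^ tau * phi c * expR (- (tau * c))) * c1) ->
  ((ln N%:R / c)%:E <=
    hausdorff_dim (Eset M Z tauk (expR (- (2 * c + ln 12))) `&` X))%E.
Proof.
move=> tss XE [x0 Xx0] ctau0 dec c10 pow c5 css q1 N0 NP.
have ln3 : 0 <= ln (3 : R) by rewrite ln_ge0 // ler1n.
have ln45 : ln 4 <= ln 5 :> R by rewrite ler_ln ?posrE // ler_nat.
have ss_ge0 := normr_ge0 ss.
have c0 : 0 < c by lra.
have ss1 : ss <= `|ss| by exact: ler_norm.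
have ss2 : - ss <= `|ss| by rewrite -normrN ler_norm.
pose e := expR (- (2 * c + ln 12)).
have e0 : 0 < e by exact: expR_gt0.
have eE : e = expR (- (2 * c)) / 12.
  by rewrite /e opprD expRD [expR (- ln 12)]expRN lnK ?posrE.
(* Positive, and [T0 - c < ss], so the windows ending at [T0 + j * c] catch every [k]. The extra
   [ln 3] in [t] makes [expR (T0 + j * c) * rho j] equal to [1 / 3]. *)
pose T0 : R := `|ss| + 1.
pose t (j : nat) : R := T0 + ln 3 + j%:R * c.
pose rho (j : nat) := expR (- t j).
have rho_gt0 j : 0 < rho j by exact: expR_gt0.
have jc j : 0 <= j%:R * c by rewrite mulr_ge0 // ltW.
have tS j : t j.+1 = t j + c by rewrite /t -natr1; ring.
have rhoS j : rho j.+1 = rho j * expR (- c) by rewrite /rho tS opprD expRD.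
have rhoE j : rho j = rho 0%N * expR (- c) ^+ j.
  by elim: j => [|j IH]; rewrite ?expr0 ?mulr1 // rhoS IH exprSr mulrA.
have b5 : expR (- c) <= 5^-1.
  by rewrite expRN lef_pV2 ?posrE ?expR_gt0 // -[leLHS]lnK ?posrE // ler_expR.
have b0 := expR_gt0 (- c).
have tst j : (ts < (t j)%:E)%E.
  apply: lt_le_trans tss _; rewrite lee_fin /t /T0.
  by have := jc j; lra.
pose F (j : nat) (x : 'cV[R]_n) := eucl_ball x (5 / 4 * rho j).
pose G (j : nat) := [set y : 'cV[R]_n | forall k,
  T0 + j%:R * c - c < ln (opnorm (M k) / tauk k) <= T0 + j%:R * c ->
  ((e * tauk k)%:E <= eucl_dist_set (M k *m y) (Z k))%E].
have lnc : - ln (expR (- c)) = c by rewrite expRK opprK.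
rewrite -[X in (ln _ / X)%:E]lnc.
apply: (@tree_dimension _ _ N (expR (- c)) (3 / 2 * (rho 0%N * expR (- c)))
  (5 / 4 * rho 0%N) X F G x0) => //.
- by rewrite b0 /=; apply: le_lt_trans b5 _; rewrite invf_lt1 // ltr1n.
- by rewrite !mulr_gt0.
- by move=> j x; exact: closed_eucl_ball.
- by move=> j x; rewrite /F /eucl_ball /= eucl_distxx mulr_ge0 // ltW.
- move=> j x y i; have -> : 5 / 4 * rho 0%N * expR (- c) ^+ j = 5 / 4 * rho j by rewrite [rho j]rhoE mulrA.
  rewrite /F /eucl_ball /=; apply: le_trans.
  by have := coord_le_eucl_norm (x - y) i; rewrite !mxE.
- move=> j x Xx.
  have [|||||||S [Ssize S0 SP]] := @window_slabs (T0 + j%:R * c) c (5 / 2 * rho j) e (rho j.+1 / 2) (F j x).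
  + exact: c0.
  + by rewrite /T0; have := jc j; lra.
  + by rewrite mulr_ge0 // ltW.
  + exact: ltW.
  (* Node diameters use up [5 / 6]; the remaining [1 / 6] is exactly what [e <= 1 / 12] requires,
     whence the [ln 12]. *)
  + have -> : expR (T0 + j%:R * c) * (5 / 2 * rho j) = 5 / 6.
      have : expR (T0 + j%:R * c) * rho j = 3^-1.
        rewrite /rho /t -expRD -[3^-1]lnK ?posrE ?invr_gt0 // lnV ?posrE //.
        congr expR; ring.
      lra.
    have : expR (- (2 * c)) <= 1 by rewrite -[leRHS]expR0 ler_expR; lra.
    rewrite eE; lra.
  + rewrite eE rhoS.
    have -> : c - (T0 + j%:R * c) = ln 3 + (c + - t j) by rewrite /t; ring.
    rewrite !expRD lnK ?posrE // -/(rho j).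
    have -> : - (2 * c) = - c + (- c) by ring.
    rewrite expRD.
    have ec : expR (- c) * expR c = 1 by rewrite -expRD addNr expR0.
    have -> : 2 * (expR (- c) * expR (- c) / 12) * (3 * (expR c * rho j)) =
      (expR (- c) * expR c) * (rho j * expR (- c) / 2) by field.
    by rewrite ec mul1r.
  + move=> y y'; rewrite /F /eucl_ball /= => yx yx'.
    have := eucl_dist_triangle x y y'; rewrite (eucl_distC y x); lra.
  have [|f fP] := separated_children (p := phi c) (S := S) (t := t j) (N := N)
     XE dec pow Xx (tst j) _ ctau0 c10 Ssize S0 q1 NP; first by lra.
  have rS : expR (- (t j + c)) = rho j.+1 by rewrite /rho tS.
  (* As [expR (- c) <= 1 / 5], the child radius is at most [rho j / 4]. *)
  have sub i : (i < N)%N -> F j.+1 (f i) `<=` F j x.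
    move=> /fP[_ xf _ _] y; rewrite /F /eucl_ball /= => fy.
    apply: le_trans (eucl_dist_triangle (f i) _ _) _.
    have : rho j.+1 <= rho j * 5^-1 by rewrite rhoS ler_pM2l.
    move: xf; rewrite -/(rho j); lra.
  have r0 := rho_gt0 j.+1.
  exists f; split.
    move=> i iN; have [Xf _ fS _] := fP i iN; split=> //; first exact: sub.
    move=> y fy; apply: SP; first exact: sub iN _ fy.
    move=> s sS; have := fS s sS; rewrite rS.
    (* The center clears the slab by [2 * rho j.+1], so the whole child clears it by
       [3 / 4 * rho j.+1], more than the [rho j.+1 / 2] asked for. *)
    have : `|dotv s.1 (f i) - dotv s.1 y| <= eucl_norm s.1 * (5 / 4 * rho j.+1).
      rewrite -dotvBr (le_trans (normr_dotv_le _ _)) // ler_wpM2l ?eucl_norm_ge0 //.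
    have := ler_distD (dotv s.1 y) (dotv s.1 (f i)) s.2.
    have : 0 <= rho j.+1 * eucl_norm s.1 by rewrite mulr_ge0 ?eucl_norm_ge0 // ltW.
    lra.
  (* Centers are [4 * rho j.+1] apart and two radii take [5 / 2 * rho j.+1]. *)
  have gap i i' y y' : (i < i')%N -> (i' < N)%N -> F j.+1 (f i) y ->
      F j.+1 (f i') y' -> 3 / 2 * rho j.+1 <= eucl_dist y y'.
    move=> ii' iN; have [_ _ _ /(_ i ii')] := fP i' iN.
    rewrite rS /F /eucl_ball /= => ff fy fy'.
    have := eucl_dist_triangle y (f i) (f i').
    have := eucl_dist_triangle y' y (f i').
    rewrite (eucl_distC y' (f i')); lra.
  move=> i i' y y' iN iN' ii' fy fy'.
  have -> : 3 / 2 * (rho 0%N * expR (- c)) * expR (- c) ^+ j = 3 / 2 * rho j.+1.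
    by rewrite rhoS [rho j]rhoE; ring.
  move: ii'; rewrite neq_ltn => /orP[ii'|ii']; first exact: gap ii' iN' fy fy'.
  by rewrite eucl_distC; exact: gap ii' iN fy' fy.
- move=> y [Xy Gy]; split.
    move=> k; have [|j jP] := @window_cover _ T0 c (ln (opnorm (M k) / tauk k)) c0.
      by have := log_ge k; rewrite /T0; lra.
    exact: (Gy j I).
  by move: Xy; rewrite XE; exact: closed_msupport.
Qed.

(** Take [N] to be the ceiling of [(1 - q) * c1 / w]. Then [ln N] is at least [delta * c - 2 * delta
    * ln 2 + ln (1 - q) - ln (c2 / c1)], and the stated error exceeds this loss because [ln 2] and
    [ln (c2 / c1)] are nonnegative. *)
Lemma decaying_dimension_bound (ts : \bar R) (mu : {measure set (borelRn R n) -> \bar R})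
    (X : set 'cV[R]_n) (tau ctau delta c1 c2 taubar : R) :
  (ts < ss%:E)%E -> X = msupport mu -> X !=set0 ->
  0 < ctau -> absolutely_decaying mu X ts tau ctau ->
  0 < c1 -> c1 <= c2 -> power_law mu X ts delta c1 c2 ->
  taubar < tau -> (forall c : R, 0 < c -> phi c <= expR (taubar * c)) ->
  exists2 c0 : R, 0 < c0 & forall c : R, c0 < c ->
    ((delta - (ln (2 * (c2 ^+ 2 / c1 ^+ 2)) + 2 * delta * ln 2
               + `|ln (1 - ctau * 2 `^ tau * phi c * expR (- (tau * c)))|)
              / c)%:E
     <= hausdorff_dim
          (Eset M Z tauk (expR (- (2 * c + ln 12))) `&` X))%E.
Proof.
move=> tss XE X0 ctau0 dec c10 c12 pow tt phi_le.
pose B := ctau * 2 `^ tau.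
have B0 : 0 < B by rewrite mulr_gt0 // powR_gt0.
have ss0 := normr_ge0 ss.
have ln5 : 0 <= ln (5 : R) by rewrite ln_ge0 // ler1n.
have Bt : 0 <= `|ln B| / (tau - taubar) by rewrite divr_ge0 // subr_ge0 ltW.
(* The summands give in turn the window condition, [ln 5 <= c], and [q < 1]. *)
exists (2 * `|ss| + 1 + ln 5 + `|ln B| / (tau - taubar)); first by lra.
move=> c cc; have c0 : 0 < c by lra.
have q1 : B * phi c * expR (- (tau * c)) < 1.
  by apply: (exponential_decay_lt1 B0 tt); [lra|exact: phi_le].
rewrite -/B in q1 *; set q := B * phi c * _ in q1 *.
have c20 : 0 < c2 by exact: lt_le_trans c12.
pose w := c2 * expR (- (delta * (c - ln 4))).
have w0 : 0 < w by rewrite mulr_gt0 // expR_gt0.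
have q10 : 0 < 1 - q by rewrite subr_gt0.
have [N [N0 NA NP]] : exists N, [/\ (0 < N)%N, (1 - q) * c1 / w <= N%:R &
    forall m, (m < N)%N -> m%:R < (1 - q) * c1 / w].
  by apply: least_natural_ge; rewrite !mulr_gt0 ?invr_gt0.
apply: (@le_trans _ _ (ln N%:R / c)%:E); last first.
  apply: (decaying_dimension tss XE X0 ctau0 dec c10 pow) => //; [by lra|by lra|exact: ltW|].
  by move=> m /NP; rewrite ltr_pdivlMr.
have lnN : ln (1 - q) + ln c1 - ln c2 + delta * (c - ln 4) <= ln N%:R.
  have -> : ln (1 - q) + ln c1 - ln c2 + delta * (c - ln 4) = ln ((1 - q) * c1 / w).
    rewrite lnM ?posrE ?mulr_gt0 ?invr_gt0 // lnM ?posrE // lnV ?posrE //.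
    rewrite /w lnM ?posrE ?expR_gt0 // expRK; ring.
  have a0 : 0 < (1 - q) * c1 / w by rewrite divr_gt0 // mulr_gt0.
  by rewrite ler_ln ?posrE ?ltr0n.
have ln4 : ln 4 = 2 * ln 2 :> R.
  by rewrite (_ : 4 = 2 ^+ 2) ?lnXn ?mulr_natl // -natrX.
have ln2 : 0 <= ln (2 : R) by rewrite ln_ge0 // ler1n.
have lnc : ln c1 <= ln c2 by rewrite ler_ln ?posrE.
have lnE : ln (2 * (c2 ^+ 2 / c1 ^+ 2)) = ln 2 + 2 * ln c2 - 2 * ln c1.
  rewrite lnM ?posrE ?divr_gt0 ?exprn_gt0 // lnM ?posrE ?invr_gt0 ?exprn_gt0 //.
  rewrite lnV ?posrE ?exprn_gt0 // !lnXn // !mulr_natl addrA //.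
have := ler_norm (- ln (1 - q)); rewrite normrN => lnq.
rewrite lee_fin ler_pdivlMr // mulrBl divfK ?gt_eqF // lnE.
move: lnN; rewrite ln4; lra.
Qed.

(** The tree has ratio [1 / (K + 1)], and level [j] uses the window of length [c] ending at [T j].
    The half-side [h j] is [expR (- T j) / (4 * n)], so that a node has Euclidean diameter at most
    [expR (- T j) / 2]. *)
Lemma cubes_dimension (c : R) (K N : nat) :
  (0 < K)%N -> K.+1%:R <= expR c -> 1 <= c -> `|ss| + 1 - ln K.+1%:R < ss ->
  (0 < N)%N ->
  (forall m, (m < N)%N ->
     m%:R < K%:R ^+ n - phi c * (n * (9 * n) * K ^ n.-1)%:R) ->
  ((ln N%:R / ln K.+1%:R)%:E <= hausdorff_dim (Eset M Z tauk (expR (- (2 * c)))))%E.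
Proof.
move=> K0 Kc c1 css N0 NP.
have n0 : 0 < n%:R :> R by rewrite ltr0n.
have KR : 0 < K%:R :> R by rewrite ltr0n.
have K1 : 0 < K.+1%:R :> R by rewrite ltr0n.
have lnK0 : 0 < ln K.+1%:R :> R by rewrite ln_gt0 // ltr1n.
have c0 : 0 < c by lra.
have lnKc : ln K.+1%:R <= c by rewrite -[leRHS]expRK ler_ln ?posrE ?expR_gt0.
pose e : R := expR (- (2 * c)).
have e0 : 0 <= e by exact: expR_ge0.
have e4 : e <= 4^-1.
  have : expR (- c) <= 2^-1.
    rewrite expRN lef_pV2 ?posrE ?expR_gt0 //; apply: le_trans Kc; rewrite ler_nat.
    exact: K0.
  rewrite /e; have -> : - (2 * c) = - c + - c by ring.
  rewrite expRD; have := expR_gt0 (- c); nra.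
pose b : R := K.+1%:R^-1.
have b0 : 0 < b by rewrite invr_gt0.
pose T0 : R := `|ss| + 1.
pose T (j : nat) : R := T0 + j%:R * ln K.+1%:R.
have T_gt0 j : 0 < T j.
  by rewrite ltr_pwDl ?mulr_ge0 ?(ltW lnK0) // /T0 ltr_wpDl.
pose h (j : nat) : R := expR (- T j) / (4 * n%:R).
have h_gt0 j : 0 < h j by rewrite divr_gt0 ?expR_gt0 ?mulr_gt0.
have hS j : h j.+1 = h j / K.+1%:R.
  rewrite /h /T -natr1 mulrDl mul1r addrA opprD expRD [expR (- ln _)]expRN lnK ?posrE //.
  by rewrite mulrAC.
have hE j : h j = h 0%N * b ^+ j.
  by elim: j => [|j IH]; rewrite ?expr0 ?mulr1 // hS IH exprSr mulrA.
pose F (j : nat) (x : 'cV[R]_n) := cube x (h j).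
pose G (j : nat) := [set y : 'cV[R]_n | forall k,
  T j - c < ln (opnorm (M k) / tauk k) <= T j ->
  ((e * tauk k)%:E <= eucl_dist_set (M k *m y) (Z k))%E].
have -> : ln K.+1%:R = - ln b by rewrite /b lnV ?posrE // opprK.
(* Per unit of [h j]: distance of neighboring cell centers minus two half-sides of shrunken
   cells. *)
pose gap : R := 2 / K%:R - 2 / K.+1%:R.
have gap0 : 0 < gap.
  by rewrite subr_gt0 ltr_pM2l // ltf_pV2 ?posrE // ltr_nat.
apply: (@tree_dimension _ _ N b (gap * h 0%N) (h 0%N) setT F G 0) => //.
- by rewrite b0 /= /b invf_lt1 // ltr1n.
- by rewrite mulr_gt0.
- by move=> j x; exact: closed_cube.
- by move=> j x i; rewrite subrr normr0 ltW.
- by move=> j x y i; rewrite -hE; exact.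
- move=> j x _.
  have eT : expR (- T j) = 4 * n%:R * h j by rewrite /h mulrC divfK ?gt_eqF ?mulr_gt0.
  have [||||||Y1 Y2|S [Ssize S0 SP]] := @window_slabs (T j) c (n%:R * (2 * h j)) e (8 * n%:R * h j / K%:R) (cube x (h j)).
  + exact: c0.
  + exact: T_gt0.
  + by rewrite !mulr_ge0 // ltW.
  + exact: e0.
  + have -> : expR (T j) * (n%:R * (2 * h j)) = 1 / 2.
      have eTT : expR (T j) * expR (- T j) = 1 by rewrite -expRD addrN expR0.
      rewrite eT in eTT; lra.
    lra.
  + rewrite expRD eT /e.
    have -> : 2 * expR (- (2 * c)) * (expR c * (4 * n%:R * h j)) =
       8 * n%:R * h j * (expR (- (2 * c)) * expR c) by ring.
    rewrite ler_wpM2l //; first by rewrite !mulr_ge0 // ltW.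
    rewrite -expRD; have -> : - (2 * c) + c = - c by ring.
    rewrite expRN lef_pV2 ?posrE ?expR_gt0 //; apply: le_trans Kc.
    by rewrite ler_nat.
  + by apply: eucl_dist_cube; exact: ltW.
  (* The slab half-width is [8 * n] times [h j / K]; one more [n] covers the distance from a cell
     center to the points of its cell. *)
  have W0 : (0 < 9 * n)%N by rewrite muln_gt0.
  have [f [finj fS]] := separated_cells x K0 (h_gt0 j) W0 Ssize S0 NP.
  have sub i : F j.+1 (cell_center x (h j) (f i)) `<=` F j x.
    by rewrite /F hS; apply: cell_sub_cube; exact: ltW.
  exists (fun i => cell_center x (h j) (f i)); split.
    move=> i iN; split; [by []|exact: sub|].
    move=> y fy; apply: SP; first exact: sub fy.
    move=> s sS; have := fS i s iN sS.
    set z := cell_center _ _ _ in fy *.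
    have : `|dotv s.1 z - dotv s.1 y| <= eucl_norm s.1 * (n%:R * (h j / K%:R)).
      rewrite -dotvBr (le_trans (normr_dotv_le _ _)) // ler_wpM2l ?eucl_norm_ge0 //.
      apply: eucl_norm_le_sup => [|i']; first by rewrite divr_ge0 // ltW.
      rewrite coordB; apply: le_trans (fy i') _; rewrite hS ler_wpM2l ?(ltW (h_gt0 j)) //.
      by rewrite lef_pV2 ?posrE // ler_nat.
    have := ler_distD (dotv s.1 y) (dotv s.1 z) s.2.
    rewrite natrM; set u := `|_ - s.2|; set v := `|_ - s.2|; set w := `|_ - _|.
    have -> : eucl_norm s.1 * (9%:R * n%:R * h j / K%:R) =
      8 * n%:R * h j / K%:R * eucl_norm s.1 + eucl_norm s.1 * (n%:R * (h j / K%:R)) by ring.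
    lra.
  move=> i i' y y' iN iN' ii' fy fy'.
  have [k kgap] := cell_center_gap x (ltW (h_gt0 j)) (finj _ _ iN iN' ii').
  rewrite -mulrA -hE; apply: (@le_trans _ _ `|y k 0 - y' k 0|); last first.
    by have := coord_le_eucl_norm (y - y') k; rewrite coordB.
  have py : `|cell_center x (h j) (f i) k 0 - y k 0| <= h j / K.+1%:R.
    by rewrite -hS; exact: fy.
  have py' : `|cell_center x (h j) (f i') k 0 - y' k 0| <= h j / K.+1%:R.
    by rewrite -hS; exact: fy'.
  move: kgap py py'; move: (cell_center _ _ _ k 0) (cell_center _ _ _ k 0) => p' p kgap py py'.
  have := ler_distD (y k 0) p p'.
  have := ler_distD (y' k 0) (y k 0) p'; rewrite (distrC (y' k 0) p').
  have -> : gap * h j = 2 * h j / K%:R - 2 * (h j / K.+1%:R) by rewrite /gap; ring.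
  by move: kgap py py'; move: (2 * h j / K%:R) (h j / K.+1%:R) => u v; lra.
(* Levels advance by [ln (K + 1) <= c], so the windows of length [c] contain tiles of length
   [ln (K + 1)]. *)
- move=> y [_ Gy] k; have [|j jP] := @window_cover _ T0 (ln K.+1%:R) (ln (opnorm (M k) / tauk k)) lnK0.
    by apply: lt_le_trans (log_ge k).
  apply: (Gy j I); rewrite -/(T j) in jP.
  by case/andP: jP => j1 ->; rewrite andbT; apply: le_lt_trans j1; rewrite lerD2l lerN2.
Qed.

(** With [K + 1] the integer part of [expR c], the number of good cells is at least
    [(K + 1) ^ n * X]. The leading term of [ln N / ln (K + 1)] is then exactly [n], and only [ln X]
    is lost. *)
Lemma cubes_dimension_bound (taubar : R) : taubar < 1 ->
  (forall c : R, 0 < c -> phi c <= expR (taubar * c)) ->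
  exists kl kbl c0 : R, [/\ 0 < kl, 0 < kbl, 0 < c0 &
    forall c : R, c0 < c ->
      ((n%:R - `|ln (1 - kbl * phi (c / 2) * expR (- (c / 2)))|
               / (c / 2 - kl))%:E
       <= hausdorff_dim (Eset M Z tauk (expR (- c))))%E].
Proof.
move=> tt phi_le.
have n0 : 0 < n%:R :> R by rewrite ltr0n.
pose D : R := (n * (9 * n))%:R.
have D0 : 0 <= D by [].
(* [2 * n] pays for shrinking the cells, [3 * D] for the slabs. *)
pose kbl : R := 2 * n%:R + 3 * D.
have kbl0 : 0 < kbl by rewrite /kbl; lra.
have ln2 : 0 < ln (2 : R) by rewrite ln_gt0 // ltr1n.
have ss0 := normr_ge0 ss.
have lnt : 0 <= `|ln kbl| / (1 - taubar) by rewrite divr_ge0 // subr_ge0 ltW.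
(* [kl] is [ln 2] since [expR c < K + 2 <= 2 * (K + 1)] gives [c - ln 2 <= ln (K + 1)], where [c] is
   half the given variable. *)
exists (ln 2), kbl, (2 * (2 * `|ss| + 3 + ln 2 + `|ln kbl| / (1 - taubar))); split => //.
  lra.
move=> c2 cc; pose c := c2 / 2; rewrite -/c.
have -> : c2 = 2 * c by rewrite /c mulrC divfK.
have {}cc : 2 * `|ss| + 3 + ln 2 + `|ln kbl| / (1 - taubar) < c by rewrite /c; lra.
have c0 : 0 < c by lra.
have phi1 : 1 <= phi c by exact: phi_ge1.
have X1 : kbl * phi c * expR (- c) < 1.
  have -> : - c = - (1 * c) by rewrite mul1r.
  by apply: (exponential_decay_lt1 kbl0 tt); [lra|exact: phi_le].
set E := expR (- c) in X1 *; set X := 1 - _.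
have E0 : 0 < E by exact: expR_gt0.
have Ec : E = (expR c)^-1 by rewrite /E expRN.
have [K [K0 Kc cK]] : exists K : nat, [/\ (0 < K)%N, K.+1%:R <= expR c & expR c < K.+2%:R].
  have c3 : 3 <= expR c by apply: le_trans (expR_ge1Dx c); lra.
  have t3 : (3 <= Num.trunc (expR c))%N by rewrite truncn_ge_nat // expR_ge0.
  exists (Num.trunc (expR c)).-1; rewrite prednK ?(leq_trans _ t3) //.
  split; first by rewrite -ltnS prednK ?(leq_trans _ t3) //.
    by rewrite truncn_le expR_ge0.
  exact: truncnS_gt.
have KR : 0 < K%:R :> R by rewrite ltr0n.
have K1 : 0 < K.+1%:R :> R by rewrite ltr0n.
pose b : R := K.+1%:R^-1.
have bE : b <= 2 * E.
  rewrite /b Ec -[leLHS]mul1r ler_pdivrMr // mulrAC ler_pdivlMr ?expR_gt0 // mul1r.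
  by apply: le_trans (ltW cK) _; rewrite -natrM ler_nat; clear -K0; lia.
have aE : K%:R^-1 <= 3 * E.
  rewrite Ec -[leLHS]mul1r ler_pdivrMr // mulrAC ler_pdivlMr ?expR_gt0 // mul1r.
  by apply: le_trans (ltW cK) _; rewrite -natrM ler_nat; clear -K0; lia.
have b01 : 0 <= b <= 1 by rewrite /b invr_ge0 ltW //= invf_le1 // ler1n.
have X0 : 0 < X by rewrite subr_gt0.
pose A : R := K%:R ^+ n - phi c * (n * (9 * n) * K ^ n.-1)%:R.
have AE : A = K.+1%:R ^+ n * ((1 - b) ^+ n * (1 - phi c * D * K%:R^-1)).
  have Kb : K.+1%:R * (1 - b) = K%:R.
    by rewrite mulrBr mulr1 divff ?gt_eqF // -natr1 addrK.
  rewrite mulrA -exprMn Kb /A natrM natrX -/D.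
  rewrite mulrBr mulr1; congr (_ - _); rewrite -{2}(prednK n_gt0) exprS.
  have -> : K%:R * K%:R ^+ n.-1 * (phi c * D * K%:R^-1) =
    phi c * (D * K%:R ^+ n.-1) * (K%:R / K%:R) by ring.
  by rewrite divff ?gt_eqF // mulr1.
(* Bernoulli bounds [(1 - b) ^+ n] from below, the slab factor is linear in [E], and the cross term
   of the product is nonnegative. *)
have AX : K.+1%:R ^+ n * X <= A.
  rewrite AE ler_wpM2l ?exprn_ge0 //.
  have y1 : 1 - 3 * D * phi c * E <= 1 - phi c * D * K%:R^-1.
    have : phi c * D * K%:R^-1 <= phi c * D * (3 * E).
      by rewrite ler_wpM2l // mulr_ge0 //; lra.
    lra.
  have u1 : 1 - 2 * n%:R * phi c * E <= (1 - b) ^+ n.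
    apply: le_trans (bernoulli_ineq n b01).
    have : n%:R * b <= n%:R * (2 * E) by rewrite ler_wpM2l.
    (* Here [1 <= phi c] absorbs the shrinking loss into the [phi] term. *)
    have : n%:R * (2 * E) * 1 <= n%:R * (2 * E) * phi c.
      by rewrite ler_wpM2l // !mulr_ge0 // ltW.
    lra.
  have pE : 0 <= phi c * E by rewrite mulr_ge0 //; lra.
  have nE : 0 <= n%:R * (phi c * E) by rewrite mulr_ge0.
  have dE : 0 <= D * (phi c * E) by rewrite mulr_ge0.
  move: X0; rewrite /X /kbl => X0.
  apply: (@le_trans _ _ ((1 - 2 * n%:R * phi c * E) * (1 - 3 * D * phi c * E))).
    have := mulr_ge0 nE dE; lra.
  by apply: ler_pM => //; lra.
have A0 : 0 < A by apply: lt_le_trans AX; rewrite mulr_gt0 // exprn_gt0.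
have [N [N0 NA NP]] := least_natural_ge A0.
pose L : R := ln K.+1%:R.
have Lc : c - ln 2 <= L.
  rewrite lerBlDl /L -lnM ?posrE // -[leLHS]expRK ler_ln ?posrE ?expR_gt0 ?mulr_gt0 //.
  by apply: le_trans (ltW cK) _; rewrite -natrM ler_nat; clear -K0; lia.
have c20 : 0 < c - ln 2 by lra.
apply: (@le_trans _ _ (ln N%:R / L)%:E); last first.
  apply: (cubes_dimension K0 Kc) => //.
    by lra.
  by rewrite -/L; have := ler_norm (- ss); rewrite normrN; lra.
have L0 : 0 < L by exact: lt_le_trans Lc.
have lnN : n%:R * L + ln X <= ln N%:R.
  rewrite mulr_natl /L -lnXn // -lnM ?posrE ?exprn_gt0 //.
  rewrite ler_ln ?posrE ?mulr_gt0 ?exprn_gt0 ?ltr0n //.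
  exact: le_trans NA.
rewrite lee_fin ler_pdivlMr //; apply: le_trans lnN; rewrite mulrBl lerD2l.
apply: (@le_trans _ _ (- `|ln X|)); last by rewrite lerNl -normrN ler_norm.
rewrite lerN2 mulrAC ler_pdivlMr // ler_wpM2l //.
Qed.

End LowerBounds.

Theorem theorem3p20 (R : realType) (n : nat) (n_gt0 : (0 < n)%N)
  (M : nat -> 'M[R]_n) (M_unit : forall k, M k \in unitmx)
  (tauk : nat -> R) (tauk_gt0 : forall k, 0 < tauk k)
  (Z : nat -> set 'cV[R]_n) (Z_sep : forall k, eucl_separated (tauk k) (Z k))
  (phi : R -> R) (phi_gt0 : forall c : R, 0 < c -> 0 < phi c)
  (phi_count : forall c t : R, 0 < c -> 0 < t ->
     (@counting nat R [set k | (t - c < ln (opnorm (M k) / tauk k) <= t)%R]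
       <= (phi c)%:E)%E)
  (ss : R) (log_ge : forall k, ss <= ln (opnorm (M k) / tauk k)) :
  (forall (ts : \bar R) (mu : {measure set (borelRn R n) -> \bar R})
     (X : set 'cV[R]_n) (tau ctau delta c1 c2 taubar : R),
     (ts < ss%:E)%E ->
     locally_finite mu -> X = msupport mu -> X !=set0 ->
     0 < tau -> 0 < ctau -> absolutely_decaying mu X ts tau ctau ->
     0 < c1 -> c1 <= c2 -> power_law mu X ts delta c1 c2 ->
     0 < taubar -> taubar < tau ->
     (forall c : R, 0 < c -> phi c <= expR (taubar * c)) ->
     exists2 c0 : R, 0 < c0 & forall c : R, c0 < c ->
       ((delta - (ln (2 * (c2 ^+ 2 / c1 ^+ 2)) + 2 * delta * ln 2
                  + `|ln (1 - ctau * 2 `^ tau * phi c * expR (- (tau * c)))|)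
                 / c)%:E
        <= hausdorff_dim
             (Eset M Z tauk (expR (- (2 * c + ln 12))) `&` X))%E)
  /\
  (forall (mu : {measure set (borelRn R n) -> \bar R}) (taubar : R),
     is_lebesgue mu ->
     0 < taubar -> taubar < 1 ->
     (forall c : R, 0 < c -> phi c <= expR (taubar * c)) ->
     exists kl kbl c0 : R, [/\ 0 < kl, 0 < kbl, 0 < c0 &
       forall c : R, c0 < c ->
         ((n%:R - `|ln (1 - kbl * phi (c / 2) * expR (- (c / 2)))|
                  / (c / 2 - kl))%:E
          <= hausdorff_dim (Eset M Z tauk (expR (- c))))%E]).

Proof.
split=> [ts mu X tau ctau delta c1 c2 taubar tss _ XE X0 _ ctau0 dec c10 c12 pow _ tt phi_le|
         mu taubar _ _ tt phi_le].
  exact: (decaying_dimension_bound n_gt0 M_unit tauk_gt0 Z_sep phi_count log_ge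
    tss XE X0 ctau0 dec c10 c12 pow tt phi_le).
exact: (cubes_dimension_bound n_gt0 M_unit tauk_gt0 Z_sep phi_count log_ge tt phi_le).
Qed.
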